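(* Let $F=\{\mathbf{p}_0,\ldots,\mathbf{p}_n\}\subset\mathbb{R}^d$ be a finite set of points not contained in any $(d-1)$-dimensional affine subspace of $\mathbb{R}^d$. Then there exists $\delta_{uni}=\delta_{uni}(F)>0$ such that for every $\lambda\in(1-\delta_{uni},1)$, the homogeneous IFS $\Phi=\{S_i\}_{i=0}^n$ with $S_i(\mathbf{x})=\lambda\mathbf{x}+(1-\lambda)\mathbf{p}_i$ satisfies $X_{uni}=\mathrm{int}(X)$.
   Context: Write $\mathcal{D}=\{0,\ldots,n\}$ and $\mathcal{D}^*=\bigcup_{j\ge0}\mathcal{D}^j$ (finite words). $X\subset\mathbb{R}^d$ denotes the unique non-empty compact set with $X=\bigcup_{i\in\mathcal{D}}S_i(X)$, and $\mathrm{int}(X)$ is its interior in $\mathbb{R}^d$. The coding map $\pi:\mathcal{D}^{\mathbb{N}}\to X$ is $\pi(\mathbf{a})=\lim_{j\to\infty}(S_{a_1}\circ\cdots\circ S_{a_j})(\mathbf{0})$; $\mathbf{a}$ is a coding of $\mathbf{x}$ if $\pi(\mathbf{a})=\mathbf{x}$. A sequence $\mathbf{a}\in\mathcal{D}^{\mathbb{N}}$ is universal if every finite word in $\mathcal{D}^*$ appears in $\mathbf{a}$ as a block of consecutive digits. $X_{uni}$ is the set of $\mathbf{x}\in X$ having at least one universal coding. *)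

(* Defs.v *)
From HB Require Import structures.
From mathcomp Require Import all_boot all_order all_algebra.
From mathcomp Require Import all_classical all_reals all_analysis.
Set Implicit Arguments. Unset Strict Implicit. Unset Printing Implicit Defensive.
Import Order.TTheory GRing.Theory Num.Theory.
Import numFieldNormedType.Exports.
Local Open Scope classical_set_scope.
Local Open Scope ring_scope.

Definition hsim {R : realType} {d : nat} (lam : R) (p : 'rV[R]_d) (x : 'rV[R]_d)
  : 'rV[R]_d := lam *: x + (1 - lam) *: p.

Fixpoint compS {I V : Type} (z : V) (S : I -> V -> V) (a : nat -> I) (k j : nat) : V :=
  match j with
  | 0 => z
  | j'.+1 => S (a k) (compS z S a k.+1 j')
  end.

(* a is a coding of x: lim_j (S_{a_1} o ... o S_{a_j})(0) = x
   (sequences are indexed from 0 instead of 1). *)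
Definition is_coding {R : realType} {d : nat} {I : Type}
  (S : I -> 'rV[R]_d -> 'rV[R]_d) (a : nat -> I) (x : 'rV[R]_d) : Prop :=
  (fun j => compS 0 S a 0 j) @ \oo --> x.

Definition appears {I : eqType} (w : seq I) (a : nat -> I) : Prop :=
  exists k, forall i, (i < size w)%N -> a (k + i)%N = nth (a k) w i.

Definition universal {I : eqType} (a : nat -> I) : Prop :=
  forall w : seq I, appears w a.

Definition X_uni {R : realType} {d : nat} {I : eqType}
  (S : I -> 'rV[R]_d -> 'rV[R]_d) : set 'rV[R]_d :=
  [set x | exists a : nat -> I, universal a /\ is_coding S a x].

Definition dotv {R : realType} {d : nat} (v x : 'rV[R]_d) : R :=
  \sum_(i < d) v 0 i * x 0 i.

(* affine (d-1)-dimensional subspaces of R^d are exactly the sets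
   {x | <v,x> = c} with v <> 0 *)
Definition in_affine_hyperplane {R : realType} {d : nat} (A : set 'rV[R]_d) : Prop :=
  exists (v : 'rV[R]_d) (c : R), v != 0 /\ forall x, A x -> dotv v x = c.

(* Main.v *)
Require Import Defs.
From HB Require Import structures.
From mathcomp Require Import all_boot all_order all_algebra.
From mathcomp Require Import all_classical all_reals all_analysis.
From mathcomp Require Import zify ring lra.
Import Order.TTheory GRing.Theory Num.Theory.
Import numFieldNormedType.Exports.
Local Open Scope classical_set_scope.
Local Open Scope ring_scope.

(* Let b = 1/lam and let O be the set of convex combinations of the p_i with positive
   weights. A universal coding uses every letter, so X_uni lies in O; O is open because
   the p_i are not in a hyperplane, and every interior point of X lies in O. It remains
   to give every point of O a universal coding.

   Put x_j = t_j / (b - 1), where the t_j are the weights. Undoing S_i multiplies x by b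
   and subtracts 1 from x_i, and the sum of the x_j stays 1 / (b - 1). A coding of the
   point is an infinite play of this game which keeps all x_j nonnegative, so it suffices
   that from any positive state one can bring x into any given small open set. Playing a
   letter with a large coordinate brings x near the center, up to a bounded error. For
   the fine adjustment a few turns in each round are reserved for choosing between the
   letters 0 and i: with g = b^(number of turns in a round), the reachable corrections are
   the differences of values at g of polynomials with coefficients 0 and 1, and they come
   in long chains with tiny gaps as soon as such differences can be arbitrarily small but
   nonzero.

   For this, suppose that distinct values of binary polynomials at b, 1 < b <= 33/32, are
   at distance at least c > 0. Comparing with a window that contains the largest possible
   number of values, one sees that bounded differences of values form a finite set, up to
   a fixed power of b; in particular b is an algebraic integer. Let P be its minimal
   polynomial, of degree D, and a_k the coefficient of X^(D-1) in X^(k+D-1) mod P, so that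
   the generating series of a is 1/P* with P* the reversal of P. By the finiteness, the
   map sending the value of a binary y to the value of this coefficient functional is
   linear up to a bounded error, whence a_(k+1) - b a_k tends to 0. Siegel's argument for
   Pisot numbers now applies: f = P/P* has integer coefficients and
   sum (f_k - b f_(k-1))^2 <= 1 + b^2 because P and P* have the same autocorrelation. As b
   is close to 1, an integer sequence can only afford this if it vanishes eventually, so
   f is constant and P = f_0 P*. Self-reciprocity then forces b + 1/b to be the integer
   a_1, which is impossible for 1 < b <= 33/32. *)

(** * Binary polynomials and their values *)

Definition evalz {R : realType} (b : R) (p : {poly int}) : R :=
  (map_poly intr p).[b].

HB.instance Definition _ (R : realType) (b : R) :=
  GRing.RMorphism.copy (evalz b) (horner_eval b \o map_poly (intr : int -> R)).

Definition binary (p : {poly int}) : Prop := forall i, (p`_i == 0) || (p`_i == 1).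

Lemma evalzX {R : realType} (b : R) : evalz b 'X = b.
Proof. by rewrite /evalz map_polyX hornerX. Qed.

Lemma evalzXn {R : realType} (b : R) k : evalz b 'X^k = b ^+ k.
Proof. by rewrite rmorphXn /= evalzX. Qed.

Lemma evalzE {R : realType} (b : R) (p : {poly int}) n : (size p <= n)%N ->
  evalz b p = \sum_(i < n) (p`_i)%:~R * b ^+ i.
Proof.
move=> pn; rewrite /evalz (@horner_coef_wide _ n).
  by apply: eq_bigr => i _; rewrite coef_map.
by rewrite (leq_trans (size_poly _ _)).
Qed.

Lemma binary0 : binary 0.
Proof. by move=> i; rewrite coef0 eqxx. Qed.

Lemma binary_Xn k : binary 'X^k.
Proof. by move=> i; rewrite coefXn; case: (i == k). Qed.

Lemma binary_mulXn p k : binary p -> binary ('X^k * p).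
Proof. by move=> bp i; rewrite coefXnM; case: ifP => // _. Qed.

Lemma binary_cat (p q : {poly int}) k : (size p <= k)%N -> binary p -> binary q ->
  binary (p + 'X^k * q).
Proof.
move=> pk bp bq i; rewrite coefD coefXnM; case: ltnP => ik.
  by rewrite addr0.
by rewrite nth_default ?add0r // (leq_trans pk).
Qed.

Lemma size_XnM_leq (p : {poly int}) k m : (size p <= m)%N -> (size ('X^k * p)%R <= k + m)%N.
Proof.
move=> pm; have [->|p0] := eqVneq p 0; first by rewrite mulr0 size_poly0.
rewrite size_monicM ?monicXn // size_polyXn addSn /= leq_add2l //.
Qed.

Lemma evalz_binary_ge0 {R : realType} (b : R) (p : {poly int}) : 0 <= b -> binary p -> 0 <= evalz b p.
Proof.
move=> b0 bp; rewrite (@evalzE _ _ _ (size p)) //; apply: sumr_ge0 => i _.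
by apply: mulr_ge0; rewrite ?exprn_ge0 // ler0z; case/orP: (bp i) => /eqP ->.
Qed.

Lemma geomE {R : realType} (b : R) m : 1 < b ->
  (b ^+ m.+1 - 1) / (b - 1) = b ^+ m + (b ^+ m - 1) / (b - 1).
Proof. by move=> b1; rewrite exprS; field; lra. Qed.

(** Digits are chosen from the top: b^m is subtracted as soon as it fits, and otherwise [b <= 2]
    keeps x in the range of the lower digits. The upper bound is the value with m digits 1, plus the
    tolerated error. *)
Lemma greedy {R : realType} (b : R) m x : 1 < b -> b <= 2 ->
  0 <= x <= (b ^+ m - 1) / (b - 1) + 1 ->
  exists y, [/\ binary y, (size y <= m)%N & `|evalz b y - x| <= 1].
Proof.
move=> b1 b2; elim: m x => [|m IH] x /andP[x0 xm].
  exists 0; rewrite rmorph0 sub0r normrN size_poly0; split => //; first exact: binary0.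
  by rewrite ger0_norm //; move: xm; rewrite expr0 subrr mul0r add0r.
have bm : 1 <= b ^+ m by rewrite exprn_ege1 // ltW.
have [xb|xb] := leP (b ^+ m) x.
  have [|y [by_ sy hy]] := IH (x - b ^+ m).
    by move: xm; rewrite geomE //; lra.
  exists (y + 'X^m * 1); split.
  - by apply: binary_cat => //; rewrite -(expr0 'X); exact: binary_Xn.
  - rewrite (leq_trans (size_polyD _ _)) // geq_max (leq_trans sy) //= mulr1.
    by rewrite size_polyXn.
  - by rewrite mulr1 rmorphD /= evalzXn; move: hy; rewrite opprB addrA addrAC -addrA (addrC (- x)) addrA addrAC.
have [|y [by_ sy hy]] := IH x; last by exists y; split => //; exact: leqW.
rewrite x0 /= (le_trans (ltW xb)) // -lerBlDr ler_pdivlMr; last lra.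
by rewrite -[leRHS]mulr1 ler_wpM2l; lra.
Qed.

Lemma bernoulli {R : realType} (b : R) k : 1 < b -> 1 + k%:R * (b - 1) <= b ^+ k.
Proof.
move=> b1; elim: k => [|k IH]; first by rewrite mul0r addr0 expr0.
rewrite exprS -natr1; have k0 : (0 : R) <= k%:R by [].
have : 0 <= b * (b ^+ k - (1 + k%:R * (b - 1))) by apply: mulr_ge0; lra.
have : 0 <= k%:R * (b - 1) ^+ 2 by rewrite mulr_ge0 // sqr_ge0.
rewrite expr2; lra.
Qed.

Lemma expr_unbounded {R : realType} (b x : R) : 1 < b -> exists m, x <= b ^+ m.
Proof.
move=> b1; have [x0|x0] := leP x 0; first by exists 0%N; rewrite expr0; lra.
set m := (Num.truncn (x / (b - 1))).+1; exists m.
have h : x / (b - 1) < m%:R by rewrite /m truncnS_gt // divr_ge0 //; lra.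
have h2 := bernoulli b m b1.
by move: h; rewrite ltr_pdivrMr; lra.
Qed.

Lemma greedy_any {R : realType} (b x : R) : 1 < b -> b <= 2 -> 0 <= x ->
  exists2 y, binary y & `|evalz b y - x| <= 1.
Proof.
move=> b1 b2 x0; have [m hm] := expr_unbounded b (1 + x * (b - 1)) b1.
have [|y [? ? ?]] := @greedy _ b m x b1 b2; last by exists y.
rewrite x0 /= ler_wpDr // ler_pdivlMr; lra.
Qed.

(** * Gaps between values and saturated windows *)

Definition gapped {R : realType} (b c : R) := forall p q, binary p -> binary q ->
  evalz b p = evalz b q \/ c <= `|evalz b p - evalz b q|.

(** Polynomials are listed instead of values because digits will be appended to them; distinctness
    concerns the values. *)
Definition window {R : realType} (b x : R) (s : seq {poly int}) :=
  [/\ (forall p, p \in s -> binary p), uniq (map (evalz b) s) &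
      forall p, p \in s -> x <= evalz b p <= x + 2].

(** By the gap, each cell of length c in the interval contains at most one value. *)
Lemma window_bounded {R : realType} (b c : R) : 0 < c -> gapped b c ->
  exists N, forall x s, window b x s -> (size s <= N)%N.
Proof.
move=> c0 gap; exists (Num.truncn (2 / c)).+1 => x s [bs us ws].
pose f p := Num.truncn ((evalz b p - x) / c).
have uf : uniq (map f s).
  rewrite map_inj_in_uniq ?(map_uniq us) // => p q ps qs fpq.
  have epq : evalz b p = evalz b q.
    case: (gap p q (bs _ ps) (bs _ qs)) => // cpq; exfalso.
    have h r : r \in s -> (f r)%:R <= (evalz b r - x) / c < (f r).+1%:R.
      by move=> rs; rewrite truncn_itv // divr_ge0 //; [have := ws _ rs; lra|lra].
    have := h _ ps; have := h _ qs; rewrite fpq.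
    rewrite !ler_pdivlMr // !ltr_pdivrMr // -natr1 => h1 h2.
    move: cpq; rewrite leNgt => /negP; apply; rewrite ltr_norml; lra.
  have /nthP := ps => /(_ 0) [i i_s ep]; have /nthP := qs => /(_ 0) [j j_s eq].
  move: epq; rewrite -ep -eq -!(nth_map 0 0) // => /eqP.
  by rewrite nth_uniq ?size_map // => /eqP ->.
have := @uniq_leq_size _ (map f s) (iota 0 (Num.truncn (2 / c)).+1) uf.
rewrite size_map size_iota; apply => _ /mapP[p ps ->].
rewrite mem_iota /= add0n ltnS /f; apply: le_truncn.
by rewrite ler_pM2r ?invr_gt0 //; have := ws _ ps; lra.
Qed.

Lemma window_cat {R : realType} (b x : R) (s : seq {poly int}) m (y : {poly int}) :
  (forall p, p \in s -> (size p <= m)%N) -> binary y -> window b x s ->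
  window b (x + b ^+ m * evalz b y) [seq p + 'X^m * y | p <- s].
Proof.
move=> sm by_ [bs us ws]; have E p : evalz b (p + 'X^m * y) = evalz b p + b ^+ m * evalz b y.
  by rewrite rmorphD rmorphM /= evalzXn.
split.
- by move=> _ /mapP[p ps ->]; apply: binary_cat => //; [exact: sm|exact: bs].
- rewrite -map_comp (eq_map (g := (fun v => v + b ^+ m * evalz b y) \o evalz b)) //.
  by rewrite map_comp map_inj_uniq //; exact: addIr.
- by move=> _ /mapP[p ps ->]; rewrite E; have := ws _ ps; lra.
Qed.

(** A window with the maximal number of values stays maximal when high digits y are appended. A
    binary value with high digits y' that falls into its interval must equal one of its values,
    since otherwise the window could be enlarged. As m is independent of y and y', only finitely
    many differences occur. *)
Lemma saturation {R : realType} (b c : R) : 1 < b -> b <= 11%:R / 10%:R -> 0 < c ->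
  gapped b c -> exists m, forall y y' : {poly int}, binary y -> binary y' ->
  `|evalz b y - evalz b y'| <= 4 ->
  exists z z' : {poly int}, [/\ binary z, binary z', (size z <= m)%N, (size z' <= m)%N &
    b ^+ m * (evalz b y - evalz b y') = evalz b z' - evalz b z].
Proof.
move=> b1 b11 c0 gap; have [N hN] := window_bounded b c c0 gap.
pose P k := `[< exists x s, window b x s /\ size s = k >].
have w1 : P 1%N.
  apply/asboolP; exists 0, [:: 0]; split => //; split => //.
  - by move=> p; rewrite inE => /eqP ->; exact: binary0.
  - by move=> p; rewrite inE => /eqP ->; rewrite rmorph0; lra.
have [||M /asboolP[x [s [ws sM]]] maxM] := @ex_maxnP P N.
- by exists 1%N.
- by move=> k /asboolP[x [s [ws <-]]]; exact: hN ws.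
pose m0 := \max_(p <- s) size p.
have sm0 p : p \in s -> (size p <= m0)%N by move=> ps; exact: (@leq_bigmax_seq _ s xpredT).
clearbody m0.
have [p0 p0s] : exists p0, p0 \in s.
  case: (s) sM (maxM _ w1) => [|p t] /= <- // _; exists p; exact: mem_head.
case: (ws) => bs us vs.
have x0 : -2 <= x.
  by have := vs _ p0s; have := evalz_binary_ge0 b p0 (le_trans ler01 (ltW b1)) (bs _ p0s); lra.
pose B := evalz b p0.
have xB : x <= B by have := vs _ p0s; rewrite -/B; lra.
have B0 : 0 <= B := evalz_binary_ge0 b p0 (le_trans ler01 (ltW b1)) (bs _ p0s).
pose e := (b - 1)^-1.
have e10 : 10%:R <= e by rewrite /e -[leRHS]mul1r ler_pdivlMr; lra.
have [m1 hm1] := expr_unbounded b (2 + B + e) b1.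
have bm0 : 1 <= b ^+ m0 by rewrite exprn_ege1 // ltW.
pose m := (m0 + m1)%N.
have bmE : b ^+ m = b ^+ m0 * b ^+ m1 by rewrite exprD.
have bm : b ^+ m0 + B + e <= b ^+ m.
  clearbody e B; rewrite bmE; have : 0 <= b ^+ m0 * (b ^+ m1 - (2 + B + e)) by apply: mulr_ge0; lra.
  have : 0 <= (b ^+ m0 - 1) * (B + e) by apply: mulr_ge0; lra.
  lra.
have ebm : 10%:R * b ^+ m <= e * b ^+ m by rewrite ler_wpM2r //; lra.
have b2 : b <= 2 by lra.
(* The middle digits y0 move the window to about half of the range e b^m of values with m digits; as
   e >= 10, a shift by up to 4 b^m stays in this range. *)
have [|y0 [by0 sy0 hy0]] := @greedy _ b m1 (b ^+ m1 * e / 2) b1 b2.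
  rewrite -/e; have : 0 <= b ^+ m1 * e by apply: mulr_ge0; lra.
  have : 0 <= (b ^+ m1 - 2) * e by apply: mulr_ge0; lra.
  by lra.
pose v0 := b ^+ m0 * evalz b y0.
have hv0 : `|v0 - b ^+ m * e / 2| <= b ^+ m0.
  rewrite bmE; have -> : v0 - b ^+ m0 * b ^+ m1 * e / 2 = b ^+ m0 * (evalz b y0 - b ^+ m1 * e / 2).
    by rewrite /v0; ring.
  by rewrite normrM ger0_norm; [rewrite -[leRHS]mulr1 ler_wpM2l //; lra|lra].
have ws1 : window b (x + v0) [seq p + 'X^m0 * y0 | p <- s] by exact: window_cat.
have sm p : p \in [seq p + 'X^m0 * y0 | p <- s] -> (size p <= m)%N.
  move=> /mapP[q qs ->]; rewrite (leq_trans (size_polyD _ _)) // geq_max.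
  by rewrite (leq_trans (sm0 _ qs)) ?leq_addr //=; exact: size_XnM_leq.
exists m => y y' by_ by' yy'.
have ws2 : window b (x + v0 + b ^+ m * evalz b y)
    [seq p + 'X^m * y | p <- [seq p + 'X^m0 * y0 | p <- s]] by exact: window_cat.
set t := b ^+ m * (evalz b y - evalz b y') in |- *.
have ht : `|t| <= 4 * b ^+ m.
  rewrite /t normrM ger0_norm; last lra.
  by rewrite mulrC ler_wpM2r //; lra.
(* This target puts the value of q below within 1 of the centre of the interval of the shifted
   window. *)
have [|z' [bz' sz' hz']] := @greedy _ b m (t + x + v0 + 1) b1 b2.
  rewrite -/e.
  move: ht hv0; rewrite !ler_norml => /andP[? ?] /andP[? ?]; lra.
pose q := z' + 'X^m * y'.
have bq : binary q by exact: binary_cat.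
have eq : evalz b q = evalz b z' + b ^+ m * evalz b y' by rewrite rmorphD rmorphM /= evalzXn.
set s2 := map _ (map _ _) in ws2.
have : evalz b q \in map (evalz b) s2.
  apply/negPn/negP => qs2.
  suff : P M.+1 by move=> /maxM; rewrite ltnn.
  apply/asboolP; exists (x + v0 + b ^+ m * evalz b y), (q :: s2); split; last first.
    by rewrite /= !size_map sM.
  case: ws2 => bs2 us2 vs2; split.
  - by move=> p; rewrite inE => /orP[/eqP ->|] //; exact: bs2.
  - by rewrite /= qs2.
  - move=> p; rewrite inE => /orP[/eqP ->|]; last exact: vs2.
    rewrite eq; move: hz'; rewrite ler_norml /t => /andP[? ?]; lra.
move=> /mapP[_ /mapP[z zs ->]]; rewrite eq rmorphD rmorphM /= evalzXn => E.
exists z, z'; split => //.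
- by case: ws1 => + _ _; exact.
- exact: sm.
- by rewrite /t mulrBr; lra.
Qed.

(** * The minimal polynomial and its coefficient functional *)

Definition minimal_monic {R : realType} (b : R) (P : {poly int}) :=
  [/\ P \is monic, evalz b P = 0 &
      forall q, q != 0 -> evalz b q = 0 -> (size P <= size q)%N].

(** Gauss's lemma: a nonzero q of least size vanishing at b divides the monic Q over the rationals,
    so its primitive part divides Q over the integers and has leading coefficient 1 or -1. *)
Lemma minimal_monic_exists {R : realType} (b : R) (Q : {poly int}) :
  Q \is monic -> evalz b Q = 0 -> exists P, minimal_monic b P.
Proof.
move=> mQ Qb.
pose A k := `[< exists q, [/\ q != 0, evalz b q = 0 & size q = k] >].
have [|k /asboolP[q [q0 qb sq]] mink] := @ex_minnP A.
  by exists (size Q); apply/asboolP; exists Q; split => //; exact: monic_neq0.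
have min r : r != 0 -> evalz b r = 0 -> (size q <= size r)%N.
  by move=> r0 rb; rewrite sq; apply: mink; apply/asboolP; exists r.
have qQ : q %| Q.
  apply/Pdiv.Idomain.modp_eq0P/eqP/negPn/negP => r0.
  have := Pdiv.Idomain.ltn_modpN0 Q q0; rewrite ltnNge min //.
  have /(congr1 (evalz b)) := Pdiv.Idomain.divp_eq Q q.
  rewrite rmorphD rmorphM /= qb mulr0 add0r => <-.
  by rewrite -mul_polyC rmorphM /= Qb mulr0.
have [r QE] := dvdpP_int qQ.
have lu : lead_coef (zprimitive q) * lead_coef r = 1.
  by rewrite -lead_coefM -QE; apply/eqP.
set l := lead_coef (zprimitive q) in lu.
have l2 : l * l = 1.
  have : l \is a GRing.unit by apply/unitrPr; exists (lead_coef r).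
  by rewrite qualifE /= => /orP[] /eqP ->.
have qpb : evalz b (zprimitive q) = 0.
  have /(congr1 (evalz b)) := zpolyEprim q; rewrite qb -mul_polyC rmorphM /=.
  rewrite /evalz map_polyC hornerC /= => /esym/eqP; rewrite mulf_eq0 intr_eq0.
  by rewrite zcontents_eq0 (negbTE q0) => /eqP.
have l0 : l != 0 by apply: contra_eq_neq l2 => ->; rewrite mul0r eq_sym oner_eq0.
exists (l *: zprimitive q); split.
- by rewrite monicE lead_coefZ l2.
- by rewrite -mul_polyC rmorphM /= qpb mulr0.
- by move=> r' r'0 r'b; rewrite size_scale // size_zprimitive; exact: min.
Qed.

Lemma monic_Xn_add (r : {poly int}) k : (size r <= k)%N -> 'X^k + r \is monic.
Proof. by move=> rk; rewrite monicE lead_coefDl ?lead_coefXn // size_polyXn ltnS. Qed.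

(** Saturation, applied to X^m and an approximation y of b^m with m digits, writes b^m (b^m - y(b))
    as a difference of values with m digits; so b is a root of X^(2m) plus terms of lower degree. *)
Lemma gapped_monic {R : realType} (b c : R) : 1 < b -> b <= 11%:R / 10%:R -> 0 < c ->
  gapped b c -> exists P, minimal_monic b P.
Proof.
move=> b1 b11 c0 gap; have [m hm] := saturation b c b1 b11 c0 gap.
have bm : 1 <= b ^+ m by rewrite exprn_ege1 // ltW.
have [||y [by_ sy hy]] := @greedy _ b m (b ^+ m) b1; first by lra.
  have : 10%:R * (b ^+ m - 1) <= (b ^+ m - 1) / (b - 1).
    by rewrite mulrC ler_wpM2l; [|lra|rewrite -[leRHS]mul1r ler_pdivlMr; lra].
  lra.
have [|z [z' [bz bz' sz sz' E]]] := hm 'X^m y (binary_Xn m) by_.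
  by rewrite evalzXn distrC; apply: le_trans hy _; rewrite ler1n.
apply: (@minimal_monic_exists _ b ('X^(m + m) + (z - z' - 'X^m * y))).
  apply: monic_Xn_add; rewrite (leq_trans (size_polyD _ _)) // geq_max size_polyN size_XnM_leq // andbT.
  rewrite (leq_trans (size_polyD _ _)) // geq_max size_polyN.
  by rewrite !(leq_trans _ (leq_addr m m)).
move: E; rewrite evalzXn exprD !(rmorphD, rmorphN, rmorphM) /= !evalzXn; lra.
Qed.

(** For P monic of degree D, [(size P).-2] is D - 1 and this is an integer linear form on
    Z[X]/(P). *)
Definition topcoef (P p : {poly int}) : int := (Pdiv.Ring.rmodp p P)`_((size P).-2).

(** The remainder vanishes at b and is shorter than P, hence zero. So [topcoef P p] depends only on
    the value of p at b. *)
Lemma topcoef_dvd {R : realType} (b : R) (P p : {poly int}) :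
  minimal_monic b P -> evalz b p = 0 -> topcoef P p = 0.
Proof.
move=> [mP Pb minP] pb; rewrite /topcoef.
suff -> : Pdiv.Ring.rmodp p P = 0 by rewrite coef0.
apply/eqP/negPn/negP => r0.
have := Pdiv.Ring.ltn_rmodpN0 p (monic_neq0 mP); rewrite ltnNge minP //.
have /(congr1 (evalz b)) := Pdiv.RingMonic.rdivp_eq mP p.
by rewrite rmorphD rmorphM /= pb Pb mulr0 add0r.
Qed.

Lemma topcoef_is_additive (P : {poly int}) : P \is monic -> {morph topcoef P : p q / p - q}.
Proof. by move=> mP p q; rewrite /topcoef Pdiv.RingMonic.rmodpB // coefB. Qed.

Lemma topcoef_sum (P : {poly int}) n (c : nat -> int) : P \is monic ->
  topcoef P (\sum_(i < n) c i *: 'X^i) = \sum_(i < n) c i * topcoef P 'X^i.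
Proof.
move=> mP; rewrite /topcoef Pdiv.RingMonic.rmodp_sum // coef_sum.
by apply: eq_bigr => i _; rewrite Pdiv.RingMonic.rmodpZ // coefZ.
Qed.

Lemma topcoef_lin (P p : {poly int}) n : P \is monic -> (size p <= n)%N ->
  topcoef P p = \sum_(i < n) p`_i * topcoef P 'X^i.
Proof.
move=> mP pn; rewrite -topcoef_sum // -poly_def; congr topcoef.
by apply/polyP => i; rewrite coef_poly; case: ltnP => // ni; rewrite nth_default // (leq_trans pn).
Qed.

Lemma topcoef_Xn (P : {poly int}) k : (k < (size P).-1)%N ->
  topcoef P 'X^k = (k == (size P).-2)%:R.
Proof.
move=> kP; rewrite /topcoef Pdiv.Ring.rmodp_small ?coefXn 1?eq_sym // size_polyXn.
by move: kP; case: (size P).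
Qed.

(** Hyers-Ulam stability. Comparing L at a product mn with multiples of L m and L n shows that every
    (L m - A) / m is at most every (L n + A) / n; the supremum of the former is a slope. *)
Lemma quasi_additive {R : realType} (L : nat -> R) (A : R) :
  (forall m n, `|L (m + n)%N - L m - L n| <= A) ->
  exists xi, forall n, `|L n - xi * n%:R| <= A.
Proof.
move=> LA.
have Lk k n : `|L (k.+1 * n)%N - k.+1%:R * L n| <= k%:R * A.
  elim: k => [|k IH]; first by rewrite mul1n mul1r subrr normr0 mul0r.
  have := LA n (k.+1 * n)%N; rewrite -mulSn; move: IH.
  rewrite -(natr1 k.+1) -(natr1 k) !ler_norml => /andP[? ?] /andP[? ?]; lra.
have A0 : 0 <= A := le_trans (normr_ge0 _) (LA 0%N 0%N).
have cmp m n : (L m.+1 - A) / m.+1%:R <= (L n.+1 + A) / n.+1%:R.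
  rewrite ler_pdivrMr // mulrAC ler_pdivlMr //.
  have := Lk n m.+1; have := Lk m n.+1; rewrite (mulnC n.+1).
  rewrite -(natr1 m) -(natr1 n) !ler_norml => /andP[? ?] /andP[? ?]; lra.
pose S := [set (L m.+1 - A) / m.+1%:R | m in [set: nat]].
have S0 : S !=set0 by exists ((L 1%N - A) / 1), 0%N.
exists (sup S) => -[|n].
  by have := LA 0%N 0%N; rewrite addn0 subrr sub0r normrN mulr0 subr0.
have h1 : (L n.+1 - A) / n.+1%:R <= sup S.
  apply: ub_le_sup; last by exists n.
  by exists ((L 1%N + A) / 1%:R) => _ [m _ <-].
have h2 : sup S <= (L n.+1 + A) / n.+1%:R.
  by apply: ge_sup => // _ [m _ <-].
move: h1 h2; rewrite ler_pdivrMr // ler_pdivlMr // ler_norml; lra.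
Qed.

(** * Quasi-linearity *)

Lemma binary_disjoint (p q : {poly int}) : binary p -> binary q ->
  (forall i, p`_i = 0 \/ q`_i = 0) -> binary (p + q).
Proof. by move=> bp bq pq i; rewrite coefD; case: (pq i) => ->; rewrite ?add0r ?addr0. Qed.

Lemma evalz_compX2 {R : realType} (b : R) p : evalz b (p \Po 'X^2) = evalz (b ^+ 2) p.
Proof. by rewrite /evalz map_comp_poly horner_comp map_polyXn hornerXn. Qed.

(** A greedy expansion in base b^2. Expansions with even and with odd exponents have disjoint
    supports, so their sum is again binary. *)
Lemma greedy_even {R : realType} (b x : R) : 1 < b -> b ^+ 2 <= 2 -> 0 <= x ->
  exists y : {poly int}, [/\ binary y, forall i, odd i -> y`_i = 0 & `|evalz b y - x| <= 1].
Proof.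
move=> b1 b2 x0.
have [|y by_ hy] := @greedy_any _ (b ^+ 2) x _ b2 x0; first by rewrite exprn_egt1.
exists (y \Po 'X^2); split; last by rewrite evalz_compX2.
- by move=> i; rewrite coef_comp_poly_Xn //; case: ifP => // _; exact: by_.
- by move=> i oi; rewrite coef_comp_poly_Xn // dvdn2 oi.
Qed.

Lemma greedy_odd {R : realType} (b x : R) : 1 < b -> b ^+ 2 <= 2 -> 0 <= x ->
  exists y : {poly int}, [/\ binary y, forall i, ~~ odd i -> y`_i = 0 & `|evalz b y - x| <= 2].
Proof.
move=> b1 b2 x0; have b0 : 0 < b := lt_trans ltr01 b1.
have [|y [by_ ey hy]] := @greedy_even _ b (x / b) b1 b2; first by rewrite divr_ge0 // ltW.
exists ('X^1 * y); split; first exact: binary_mulXn.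
- by move=> [|i]; rewrite coefXnM //= negbK subn1 => oi; exact: ey.
- have -> : evalz b ('X^1 * y) - x = b * (evalz b y - x / b).
    by rewrite rmorphM /= evalzXn expr1 mulrBr mulrCA divff ?mulr1 // gt_eqF.
  rewrite normrM gtr0_norm //.
  have : b * `|evalz b y - x / b| <= b * 1 by rewrite ler_wpM2l // ltW.
  by have : b * 1 <= b * b by [rewrite ler_wpM2l // ltW]; rewrite -expr2; lra.
Qed.

(** Let E n and F n approximate n with even and odd exponents. Then E m + F n is binary and close to
    E (m + n), so n |-> g (E n) is additive up to a bounded error. The 4 in the hypothesis is the
    sum 1 + 1 + 2 of the errors of E (m + n), E m and F n. *)
Lemma quasi_linear {R : realType} (b K : R) (g : {poly int} -> R) :
  1 < b -> b ^+ 2 <= 2 -> {morph g : p q / p + q} ->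
  (forall y y' : {poly int}, binary y -> binary y' -> `|evalz b y - evalz b y'| <= 4 -> `|g y - g y'| <= K) ->
  exists xi A, forall y, binary y -> `|g y - xi * evalz b y| <= A.
Proof.
move=> b1 b2 gD gK.
have /choice [E hE] : forall n : nat, exists y : {poly int},
  [/\ binary y, forall i, odd i -> y`_i = 0 & `|evalz b y - n%:R| <= 1].
  by move=> n; exact: greedy_even.
have /choice [F hF] : forall n : nat, exists y : {poly int},
  [/\ binary y, forall i, ~~ odd i -> y`_i = 0 & `|evalz b y - n%:R| <= 2].
  by move=> n; exact: greedy_odd.
have [m n|xi hxi] := @quasi_additive _ (fun n => g (E n)) (2 * K).
  have [bm em hm] := hE m; have [bmn _ hmn] := hE (m + n)%N.
  have [bn _ hn] := hE n; have [bo oo ho] := hF n.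
  have h1 : `|g (E (m + n)%N) - g (E m + F n)| <= K.
    apply: gK => //.
      apply: binary_disjoint => // i; case: (boolP (odd i)) => oi; first by left; exact: em.
      by right; exact: oo.
    rewrite rmorphD /=; move: hm hmn ho; rewrite natrD !ler_norml => /andP[? ?] /andP[? ?] /andP[? ?]; lra.
  have h2 : `|g (F n) - g (E n)| <= K.
    apply: gK => //.
    move: hn ho; rewrite !ler_norml => /andP[? ?] /andP[? ?]; lra.
  move: h1 h2; rewrite gD !ler_norml => /andP[? ?] /andP[? ?]; lra.
exists xi, (3 * K + `|xi| * 2) => y by_.
set v := evalz b y.
have v0 : 0 <= v by apply: evalz_binary_ge0 => //; lra.
have := truncn_itv v0; set n := Num.truncn v; rewrite -natr1 => /andP[nv vn].
have [bn _ hn] := hE n.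
have h1 : `|g y - g (E n)| <= K.
  apply: gK => //; move: hn; rewrite -/v !ler_norml => /andP[? ?]; lra.
have h2 : `|xi * n%:R - xi * v| <= `|xi| * 2.
  rewrite -mulrBr normrM ler_wpM2l // ler_norml; lra.
move: h1 h2 (hxi n); rewrite !ler_norml => /andP[? ?] /andP[? ?] /andP[? ?]; lra.
Qed.

Lemma sum_bounded_vanish {R : realType} (u : nat -> R) (B : R) :
  (forall k, 0 <= u k) -> (forall N, \sum_(k < N) u k <= B) ->
  forall e, 0 < e -> exists M, forall k, (M <= k)%N -> u k < e.
Proof.
move=> u0 uB e e0.
have : cvgn (series u).
  apply: nondecreasing_is_cvgn.
    by apply/nondecreasing_series => n _ _; exact: u0.
  by exists B => _ [n _ <-]; rewrite /series /= big_mkord.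
move=> /cvg_series_cvg_0 /cvgrPdist_lt /(_ _ e0) [M _ hM].
by exists M => k /hM /=; rewrite sub0r normrN ger0_norm.
Qed.

Lemma binary_sum_Xn (Q : pred nat) N : binary (\sum_(k < N | Q k) 'X^k).
Proof.
move=> i; rewrite coef_sum.
under eq_bigr do rewrite coefXn.
case: (ltnP i N) => [iN|Ni]; last first.
  by rewrite big1 // => k _; rewrite gtn_eqF // (leq_trans (ltn_ord k)).
case: (boolP (Q i)) => Qi; last first.
  by rewrite big1 // => k Qk; case: eqP => // ik; move: Qi; rewrite ik Qk.
rewrite (bigD1 (Ordinal iN)) //= eqxx big1 ?addr0 // => k /andP[_].
by rewrite -val_eqE /= eq_sym => /negbTE ->.
Qed.

(** The errors at the powers X^k of one sign add up to the error at a binary polynomial, which is at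
    most A in modulus. Hence the series of their moduli is bounded by 2A. *)
Lemma quasi_linear_vanish {R : realType} (b xi A : R) (g : {poly int} -> R) :
  {morph g : p q / p + q} ->
  (forall y, binary y -> `|g y - xi * evalz b y| <= A) ->
  forall e, 0 < e -> exists M, forall k, (M <= k)%N -> `|g 'X^k - xi * b ^+ k| < e.
Proof.
move=> gD gA; apply: (@sum_bounded_vanish _ _ (A + A)) => // N.
pose G y := g y - xi * evalz b y.
have GD : {morph G : p q / p + q} by move=> p q; rewrite /G gD rmorphD /=; ring.
have G0 : G 0 = 0 by apply: (addrI (G 0)); rewrite -GD !addr0.
have GE (Q : pred nat) : \sum_(k < N | Q k) (g 'X^k - xi * b ^+ k) = G (\sum_(k < N | Q k) 'X^k).
  rewrite (big_morph G GD G0); apply: eq_bigr => k _.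
  by rewrite /G evalzXn.
rewrite (bigID (fun k : 'I_N => 0 <= g 'X^k - xi * b ^+ k)) /=.
rewrite (eq_bigr (fun k : 'I_N => g 'X^k - xi * b ^+ k)); last by move=> k /ger0_norm.
rewrite [X in _ + X <= _](eq_bigr (fun k : 'I_N => - (g 'X^k - xi * b ^+ k))); last first.
  by move=> k; rewrite -ltNge => /ltr0_norm.
rewrite sumrN (GE (fun k => 0 <= g 'X^k - xi * b ^+ k)) (GE (fun k => ~~ (0 <= g 'X^k - xi * b ^+ k))).
have := gA _ (binary_sum_Xn (fun k => 0 <= g 'X^k - xi * b ^+ k) N).
have := gA _ (binary_sum_Xn (fun k => ~~ (0 <= g 'X^k - xi * b ^+ k)) N).
rewrite -/(G _) -/(G _) !ler_norml => /andP[? ?] /andP[? ?]; lra.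
Qed.

(** By saturation, X^m (y - y') has the same [topcoef] as some z' - z with m coefficients among -1,
    0, 1, which gives the bound needed for quasi-linearity of [g]. Then [g] at X^k is close to xi
    b^k, and consecutive terms have ratio nearly b. *)
Lemma topcoef_vanish {R : realType} (b c : R) (P : {poly int}) :
  1 < b -> b <= 11%:R / 10%:R -> 0 < c -> gapped b c -> minimal_monic b P ->
  forall e : R, 0 < e -> exists M, forall k, (M <= k)%N ->
  `|(topcoef P 'X^(k.+1))%:~R - b * (topcoef P 'X^k)%:~R| < e.
Proof.
move=> b1 b11 c0 gap mP e e0.
have monP : P \is monic by case: mP.
have [m hm] := saturation b c b1 b11 c0 gap.
pose g p : R := (topcoef P ('X^m * p))%:~R.
have tB := topcoef_is_additive P monP.
have t0 : topcoef P 0 = 0 by rewrite -{1}(subr0 0) tB subrr.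
have tD p q : topcoef P (p + q) = topcoef P p + topcoef P q.
  by rewrite -{1}[q]opprK -[- q]sub0r !tB t0 sub0r opprK.
have gD : {morph g : p q / p + q} by move=> p q; rewrite /g mulrDr tD intrD.
have b2 : b ^+ 2 <= 2.
  have : b ^+ 2 <= (11%:R / 10%:R) ^+ 2 by rewrite lerXn2r // ?nnegrE; lra.
  by rewrite expr2; lra.
have [|xi [A gA]] := @quasi_linear _ b (\sum_(k < m) `|topcoef P 'X^k|%:~R) g b1 b2 gD.
  move=> y y' by_ by' yy'; have [z [z' [bz bz' sz sz' E]]] := hm y y' by_ by' yy'.
  rewrite /g -intrB -tB.
  have -> : topcoef P ('X^m * y - 'X^m * y') = topcoef P (z' - z).
    apply/eqP; rewrite -subr_eq0 -tB; apply/eqP/(topcoef_dvd b) => //.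
    by rewrite !(rmorphB, rmorphM) /= evalzXn; rewrite mulrBr in E; lra.
  rewrite (topcoef_lin _ _ m) //; last first.
    by rewrite (leq_trans (size_polyD _ _)) // geq_max size_polyN sz sz'.
  rewrite -intr_norm -rmorph_sum /= ler_int.
  apply: le_trans (ler_norm_sum _ _ _) _; apply: ler_sum => k _.
  rewrite normrM -[leRHS]mul1r ler_wpM2r // coefB.
  by case/orP: (bz k) => /eqP ->; case/orP: (bz' k) => /eqP ->.
have [|M hM] := quasi_linear_vanish b xi A g gD gA (e / 3); first by rewrite divr_gt0.
exists (m + M)%N => k mk.
have gE j : (M <= j)%N -> `|(topcoef P 'X^(m + j))%:~R - xi * b ^+ j| < e / 3.
  by move=> /hM; rewrite /g -exprD.
have kE : k = (m + (k - m))%N by rewrite subnKC // (leq_trans (leq_addr _ _) mk).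
have Mk : (M <= k - m)%N by rewrite leq_subRL // (leq_trans (leq_addr _ _) mk).
have := gE _ Mk; have := gE _ (leqW Mk); rewrite addnS -kE (exprS b) !ltr_norml.
set u := (topcoef P 'X^k)%:~R; set u' := (topcoef P 'X^(k.+1))%:~R.
move=> /andP[? ?] /andP[? ?].
have : b * (- (e / 3)) < b * (u - xi * b ^+ (k - m)) by rewrite ltr_pM2l //; lra.
have : b * (u - xi * b ^+ (k - m)) < b * (e / 3) by rewrite ltr_pM2l //; lra.
have : b * (e / 3) <= (11%:R / 10%:R) * (e / 3) by rewrite ler_wpM2r //; lra.
rewrite mulrN; lra.
Qed.

(** * Reversed polynomials *)

Definition dotp {R : realType} (u v : {poly R}) : R := \sum_(i < size u) u`_i * v`_i.

Lemma dotpE {R : realType} (u v : {poly R}) N : (size u <= N)%N ->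
  dotp u v = \sum_(i < N) u`_i * v`_i.
Proof.
move=> uN; rewrite /dotp (big_ord_widen N (fun i => u`_i * v`_i)) //.
rewrite [RHS](bigID (fun i : 'I_N => (i < size u)%N)) /= [X in _ = _ + X]big1 ?addr0 //.
by move=> i; rewrite -leqNgt => ui; rewrite nth_default ?mul0r.
Qed.

Lemma dotpC {R : realType} (u v : {poly R}) : dotp u v = dotp v u.
Proof.
rewrite (dotpE u v (maxn (size u) (size v))) ?leq_maxl //.
rewrite (dotpE v u (maxn (size u) (size v))) ?leq_maxr //.
by apply: eq_bigr => i _; rewrite mulrC.
Qed.

Lemma dotp_suml {R : realType} (v : {poly R}) n (c : nat -> R) (F : nat -> {poly R}) :
  dotp (\sum_(i < n) c i *: F i) v = \sum_(i < n) c i * dotp (F i) v.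
Proof.
pose N := maxn (size (\sum_(i < n) c i *: F i)) (\max_(i < n) size (F i)).
rewrite (dotpE _ _ N) ?leq_maxl //.
under [RHS]eq_bigr => i _.
  rewrite (dotpE _ _ N); last by rewrite leq_max (@leq_bigmax _ (fun i : 'I_n => size (F i)) i) orbT.
  rewrite mulr_sumr; over.
rewrite exchange_big /=; apply: eq_bigr => k _.
by rewrite coef_sum mulr_suml; apply: eq_bigr => i _; rewrite coefZ mulrA.
Qed.

Lemma dotp_sumr {R : realType} (v : {poly R}) n (c : nat -> R) (F : nat -> {poly R}) :
  dotp v (\sum_(i < n) c i *: F i) = \sum_(i < n) c i * dotp v (F i).
Proof. by rewrite dotpC dotp_suml; apply: eq_bigr => i _; rewrite dotpC. Qed.

Lemma dotpZl {R : realType} (c : R) (u v : {poly R}) : dotp (c *: u) v = c * dotp u v.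
Proof.
have := @dotp_suml _ v 1 (fun=> c) (fun=> u).
by rewrite !big_ord_recl !big_ord0 !addr0.
Qed.

Lemma dotp_shift {R : realType} (u v : {poly R}) s : dotp ('X^s * u) ('X^s * v) = dotp u v.
Proof.
rewrite (dotpE ('X^s * u) _ (s + size u)); last first.
  have [->|u0] := eqVneq u 0; first by rewrite mulr0 size_poly0.
  by rewrite size_monicM ?monicXn // size_polyXn.
rewrite big_split_ord /= big1 ?add0r; last first.
  by move=> i _; rewrite coefXnM ltn_ord mul0r.
by apply: eq_bigr => i _; rewrite !coefXnM ltnNge leq_addr /= addKn.
Qed.

(** Both sides depend only on the difference of the shifts, which is i - j in either case. *)
Lemma dotp_reflect {R : realType} (u v : {poly R}) D i j : (i <= D)%N -> (j <= D)%N ->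
  dotp ('X^i * u) ('X^j * v) = dotp ('X^(D - j) * u) ('X^(D - i) * v).
Proof.
move=> iD jD; case: (leqP (i + j) D) => ijD.
  have [s si sj] : exists2 s, (D - j = s + i)%N & (D - i = s + j)%N.
    by exists (D - i - j)%N; lia.
  by rewrite si sj !exprD -!mulrA dotp_shift.
have -> : ('X^i : {poly R}) = 'X^(i + j - D) * 'X^(D - j) by rewrite -exprD; congr ('X^_); lia.
have -> : ('X^j : {poly R}) = 'X^(i + j - D) * 'X^(D - i) by rewrite -exprD; congr ('X^_); lia.
by rewrite -!mulrA dotp_shift.
Qed.

(** For p of degree at most D this is X^D p(1/X). *)
Definition revp {R : nzRingType} (D : nat) (p : {poly R}) := \poly_(i < D.+1) p`_(D - i).

Lemma coef_revp {R : nzRingType} D (p : {poly R}) i :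
  (revp D p)`_i = if (i <= D)%N then p`_(D - i) else 0.
Proof. by rewrite coef_poly ltnS. Qed.

Lemma mulp_sum {R : realType} (p u : {poly R}) n : (size p <= n)%N ->
  p * u = \sum_(i < n) p`_i *: ('X^i * u).
Proof.
move=> pn; rewrite -[p in LHS]coefK poly_def mulr_suml.
rewrite (big_ord_widen n (fun i => p`_i *: 'X^i * u)) //.
rewrite [RHS](bigID (fun i : 'I_n => (i < size p)%N)) /= [X in _ = _ + X]big1 ?addr0.
  by apply: eq_bigr => i _; rewrite scalerAl.
by move=> i; rewrite -leqNgt => pi; rewrite nth_default ?scale0r.
Qed.

Lemma revp_sum {R : realType} (p u : {poly R}) D :
  revp D p * u = \sum_(i < D.+1) p`_(D - i) *: ('X^i * u).
Proof.
rewrite (mulp_sum _ _ D.+1) ?size_poly //; apply: eq_bigr => i _.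
by rewrite coef_revp -ltnS ltn_ord.
Qed.

(** On the unit circle p and its reversal have the same modulus. Algebraically: expand bilinearly,
    reverse both indices and reflect the shifts. *)
Lemma dotp_revp {R : realType} (p u : {poly R}) D : (size p <= D.+1)%N ->
  dotp (revp D p * u) (revp D p * u) = dotp (p * u) (p * u).
Proof.
move=> pD; rewrite revp_sum (mulp_sum p u D.+1) //.
rewrite (dotp_suml _ D.+1 (fun i => p`_(D - i)) (fun i => 'X^i * u)).
rewrite (dotp_suml _ D.+1 (fun i => p`_i) (fun i => 'X^i * u)).
under eq_bigr => i _ do
  rewrite (dotp_sumr _ D.+1 (fun i => p`_(D - i)) (fun i => 'X^i * u)) mulr_sumr.
under [RHS]eq_bigr => i _ do
  rewrite (dotp_sumr _ D.+1 (fun i => p`_i) (fun i => 'X^i * u)) mulr_sumr.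
rewrite exchange_big (reindex_inj rev_ord_inj) /=; apply: eq_bigr => i _.
rewrite (reindex_inj rev_ord_inj) /=; apply: eq_bigr => j _.
have iD : (i <= D)%N by rewrite -ltnS.
have jD : (j <= D)%N by rewrite -ltnS.
rewrite !subSS !subKn // (dotp_reflect u u D i j iD jD).
by rewrite mulrCA.
Qed.

(** On the unit circle the conjugate of p is X^(-D) times its reversal, so multiplication by the
    latter is, up to the shift by D, the adjoint of multiplication by p. *)
Lemma dotp_revp_adjoint {R : realType} (p u v : {poly R}) D : (size p <= D.+1)%N ->
  dotp ('X^D * u) (revp D p * v) = dotp (p * u) v.
Proof.
move=> pD; rewrite revp_sum (mulp_sum p u D.+1) //.
rewrite (dotp_sumr _ D.+1 (fun i => p`_(D - i)) (fun i => 'X^i * v)).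
rewrite (dotp_suml _ D.+1 (fun i => p`_i) (fun i => 'X^i * u)).
rewrite (reindex_inj rev_ord_inj) /=; apply: eq_bigr => i _.
have iD : (i <= D)%N by rewrite -ltnS.
rewrite subSS subKn // (dotp_reflect u v D D (D - i)) ?leq_subr //.
by rewrite subnn subKn // mul1r.
Qed.

Lemma coefM_agree {R : nzRingType} (p q r : {poly R}) k :
  (forall i, (i <= k)%N -> q`_i = r`_i) -> (p * q)`_k = (p * r)`_k.
Proof. by move=> qr; rewrite !coefM; apply: eq_bigr => i _; rewrite qr // leq_subr. Qed.

Lemma sum_norm_coef_le {R : realType} (p : {poly R}) n :
  \sum_(j < n) `|p`_j| <= \sum_(j < size p) `|p`_j|.
Proof.
apply: (@le_trans _ _ (\sum_(j < size p + n) `|p`_j|)).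
  rewrite (addnC (size p)) big_split_ord /= lerDl; exact: sumr_ge0.
rewrite big_split_ord /= [X in _ + X]big1 ?addr0 // => i _.
by rewrite nth_default ?normr0 // leq_addr.
Qed.

(** Beyond the cut K, a coefficient of the product involves only terms [h i] with i >= K - D, and
    these are small. *)
Lemma coef_tail {R : realType} (p : {poly R}) (h : nat -> R) D : (size p <= D.+1)%N ->
  (forall e : R, 0 < e -> exists M, forall k, (M <= k)%N -> `|h k| < e) ->
  forall e, 0 < e -> exists K0, forall K, (K0 <= K)%N ->
    (forall k, (K <= k)%N -> `|(p * \poly_(i < K) h i)`_k| <= e) /\
    (forall i, (K - D <= i)%N -> `|(\poly_(i < K) h i)`_i| <= e).
Proof.
move=> pD h0 e e0; pose S := \sum_(j < size p) `|p`_j|.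
have S0 : 0 <= S by exact: sumr_ge0.
have eS : 0 < e / (S + 1) by rewrite divr_gt0 //; lra.
have [M hM] := h0 _ eS; exists (M + D)%N => K MK.
have hK i : (K - D <= i)%N -> `|(\poly_(i < K) h i)`_i| <= e / (S + 1).
  move=> Ki; rewrite coef_poly; case: ifP => _; last by rewrite normr0 ltW.
  by apply/ltW/hM; lia.
split=> [k Kk|i Ki]; last first.
  apply: le_trans (hK _ Ki) _; rewrite ler_pdivrMr; last lra.
  by rewrite -[leLHS]mulr1 ler_wpM2l; lra.
rewrite coefM; apply: le_trans (ler_norm_sum _ _ _) _.
apply: (@le_trans _ _ (\sum_(j < k.+1) `|p`_j| * (e / (S + 1)))).
  apply: ler_sum => j _; rewrite normrM.
  case: (leqP j D) => jD; last by rewrite nth_default ?normr0 ?mul0r // (leq_trans pD).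
  by rewrite ler_wpM2l // hK; lia.
rewrite -mulr_suml (@le_trans _ _ (S * (e / (S + 1)))) //.
  rewrite ler_wpM2r ?(ltW eS) //; exact: sum_norm_coef_le.
rewrite mulrA ler_pdivrMr; last lra.
by rewrite mulrC ler_wpM2l; lra.
Qed.

(** * Siegel's argument *)

(** The coefficients of (1 - bX) times the generating series of a. *)
Definition bdiff {R : realType} (b : R) (a : nat -> int) (k : nat) : R :=
  (a k)%:~R - b * (if k is j.+1 then (a j)%:~R else 0).

(** The coefficients of p times the generating series of a. *)
Definition conv (p : {poly int}) (a : nat -> int) (k : nat) : int :=
  \sum_(j < k.+1) p`_j * a (k - j)%N.

Lemma coefM_bdiff {R : realType} (b : R) (p : {poly int}) (a : nat -> int) K k :
  (k < K)%N ->
  (map_poly intr p * \poly_(i < K) bdiff b a i)`_k = bdiff b (conv p a) k.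
Proof.
move=> kK; rewrite coefM.
have E : forall j : 'I_k.+1, (map_poly intr p)`_j * (\poly_(i < K) bdiff b a i)`_(k - j) =
   (p`_j * a (k - j)%N)%:~R - b * ((p`_j)%:~R * (if (k - j)%N is i.+1 then (a i)%:~R else 0)).
  move=> j; rewrite coef_map coef_poly (leq_ltn_trans (leq_subr _ _) kK) /bdiff /=.
  by rewrite intrM mulrBr mulrCA.
rewrite (eq_bigr _ (fun j _ => E j)) sumrB -mulr_sumr /bdiff /conv -rmorph_sum /=.
congr (_ - b * _); case: k kK {E} => [|k] kK.
  by rewrite big_ord_recl big_ord0 subnn mulr0 addr0.
rewrite big_ord_recr /= subnn mulr0 addr0 rmorph_sum /=.
by apply: eq_bigr => j _; rewrite (subSn (leq_ord j)) intrM.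
Qed.

(* If [f] moves from a value of modulus at most 16 then [f k - b f (k-1)] is within
   1/2 of the nonzero integer [f k - f (k-1)], so the total variation of [f] is at
   most four times the sum of squares; this keeps [f] in that range for ever, where
   every nonzero term costs at least [(b - 1)^2]. *)
Lemma slow_integer_sequence {R : realType} (b : R) (f : nat -> int) :
  1 < b -> b <= 33%:R / 32%:R -> (forall N, \sum_(k < N) bdiff b f k ^+ 2 <= 4) ->
  exists M, forall k, (M <= k)%N -> f k = 0.
Proof.
move=> b1 b33 sum4.
have step (x y : int) : `|x%:~R| <= 16%:R :> R -> y != x ->
    `|(y%:~R : R) - x%:~R| <= 4 * (y%:~R - b * x%:~R) ^+ 2 /\
    1 / 2 <= `|y%:~R - b * x%:~R|.
  move=> x16 yx; set d : R := y%:~R - x%:~R.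
  have d1 : 1 <= `|d|.
    rewrite /d -intrB -intr_norm -[leLHS]/(1%:~R) ler_int.
    by rewrite -gtz0_ge1 normr_gt0 subr_eq0.
  have x12 : `|(b - 1) * x%:~R| <= 1 / 2.
    rewrite normrM gtr0_norm ?subr_gt0 //.
    by apply: (@le_trans _ _ ((1 / 32%:R) * 16%:R)); [apply: ler_pM => //; lra|lra].
  have -> : y%:~R - b * x%:~R = d - (b - 1) * x%:~R by rewrite /d; ring.
  have e2 : `|d| / 2 <= `|d - (b - 1) * x%:~R|.
    by apply: le_trans (lerB_dist _ _); lra.
  split; last lra.
  rewrite -real_normK ?num_real //.
  have : (`|d| / 2) ^+ 2 <= `|d - (b - 1) * x%:~R| ^+ 2.
    by rewrite lerXn2r // nnegrE; lra.
  have : 0 <= (`|d| - 1) * `|d| by apply: mulr_ge0; lra.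
  rewrite !expr2; lra.
have f16 k : `|(f k)%:~R| <= 4 * \sum_(j < k.+1) bdiff b f j ^+ 2.
  elim: k => [|k IH].
    rewrite big_ord_recl big_ord0 addr0 /bdiff mulr0 subr0.
    have [->|f0] := eqVneq (f 0%N) 0; first by rewrite normr0 expr2 !mulr0.
    have f1 : 1 <= `|(f 0%N)%:~R| :> R.
      by rewrite -intr_norm -[leLHS]/(1%:~R) ler_int -gtz0_ge1 normr_gt0.
    rewrite -[X in _ <= _ * X]real_normK ?num_real //.
    have : 0 <= (`|(f 0%N)%:~R| - 1) * `|(f 0%N)%:~R| :> R by apply: mulr_ge0; lra.
    rewrite expr2; lra.
  rewrite big_ord_recr /= mulrDr.
  have fk16 : `|(f k)%:~R| <= 16%:R :> R by have := sum4 k.+1; lra.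
  have [fkk|fkk] := eqVneq (f k.+1) (f k).
    rewrite fkk; have := sqr_ge0 (bdiff b f k.+1); lra.
  have [h _] := step _ _ fk16 fkk.
  have := ler_normD ((f k.+1)%:~R - (f k)%:~R : R) (f k)%:~R; rewrite subrK.
  move: h; rewrite /bdiff; lra.
have [||M hM] := @sum_bounded_vanish _ (fun k => bdiff b f k ^+ 2) 4 _ sum4 ((b - 1) ^+ 2).
- by move=> k; exact: sqr_ge0.
- by rewrite exprn_gt0 //; lra.
exists M => k Mk; apply/eqP/negPn/negP => fk0.
have fk16 : `|(f k)%:~R| <= 16%:R :> R by have := sum4 k.+1; have := f16 k; lra.
have := hM _ (leqW Mk); rewrite ltNge => /negP; apply.
have b0 : 0 <= b - 1 by lra.
rewrite /bdiff -[leRHS]real_normK ?num_real // lerXn2r // ?nnegrE //.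
have [->|fkk] := eqVneq (f k.+1) (f k); last by have [_] := step _ _ fk16 fkk; lra.
have -> : (f k)%:~R - b * (f k)%:~R = (1 - b) * (f k)%:~R :> R by rewrite mulrBl mul1r.
rewrite normrM distrC (ger0_norm b0).
rewrite -[leLHS]mulr1 ler_wpM2l //.
by rewrite -intr_norm -[leLHS]/(1%:~R) ler_int -gtz0_ge1 normr_gt0.
Qed.

Lemma map_revp {R : realType} D (p : {poly int}) :
  map_poly (intr : int -> R) (revp D p) = revp D (map_poly intr p).
Proof. by apply/polyP => i; rewrite coef_map !coef_revp coef_map /=; case: ifP. Qed.

Lemma bdiff_delta {R : realType} (b : R) k (a : nat -> int) :
  (forall k, a k = (k == 0%N)%:R) -> bdiff b a k = (k == 0%N)%:R - b * (k == 1%N)%:R.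
Proof. by move=> aE; case: k => [|[|k]]; rewrite /bdiff !aE /= ?mulr0 //= ?mulr0. Qed.

Lemma siegel {R : realType} (b : R) (P : {poly int}) (a : nat -> int) D :
  1 < b -> b <= 33%:R / 32%:R -> (2 <= D)%N -> size P = D.+1 -> P`_D = 1 -> P`_0 != 0 ->
  (forall k, conv (revp D P) a k = (k == 0%N)%:R) ->
  (forall e : R, 0 < e -> exists M, forall k, (M <= k)%N ->
     `|(a k.+1)%:~R - b * (a k)%:~R| < e) -> False.
Proof.
move=> b1 b33 D2 sP PD P0 aP a0.
(* [h K] is (1 - bX) / [revp D P] cut at degree K. Its product with the reversal is 1 - bX below
   degree K and, for large K, small beyond. *)
pose p : {poly R} := map_poly intr P; pose h K := \poly_(i < K) bdiff b a i.
have sp : (size p <= D.+1)%N by rewrite -sP size_poly.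
have h0 (e : R) : 0 < e -> exists M, forall k, (M <= k)%N -> `|bdiff b a k| < e.
  move=> /a0 [M hM]; exists M.+1 => -[//|k] Mk; exact: hM.
have a00 : a 0%N = 1.
  by have := aP 0%N; rewrite /conv big_ord_recl big_ord0 addr0 coef_revp subn0 PD mul1r.
have lowE K (k : nat) : (k < K)%N -> (revp D p * h K)`_k = (k == 0%N)%:R - b * (k == 1%N)%:R.
  by move=> kK; rewrite -map_revp coefM_bdiff //; exact: bdiff_delta.
have sh K : (size (revp D p * h K)%R <= K + D)%N.
  apply: leq_trans (size_polyMleq _ _) _.
  have := size_poly D.+1 (fun i => p`_(D - i)); have := size_poly K (bdiff b a); rewrite -/(h K) -/(revp D p).
  by move: (size _) (size _) => x y; lia.
have srev : (size (revp D p) <= D.+1)%N by exact: size_poly.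
have b2 : b ^+ 2 <= 11%:R / 10%:R.
  have : b ^+ 2 <= (33%:R / 32%:R) ^+ 2 by rewrite lerXn2r // nnegrE; lra.
  rewrite expr2; lra.
pose f := conv P a.
have D0 : 0 < D%:R :> R by rewrite ltr0n; lia.
have D1 : 1 <= D%:R :> R by rewrite ler1n; lia.
have fsum N : \sum_(k < N) bdiff b f k ^+ 2 <= 4.
  (* With this bound the D coefficients beyond K add at most 1/2 to the sum of squares 1 + b^2. *)
  have e0 : 0 < (2 * D%:R)^-1 :> R by rewrite invr_gt0 mulr_gt0.
  have e1 : (2 * D%:R)^-1 <= 1 :> R by rewrite invf_le1 ?mulr_gt0 //; lra.
  have [K0 hK0] := coef_tail (revp D p) (bdiff b a) D srev h0 _ e0.
  pose K := (K0 + N + D)%N.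
  have [|hK _] := hK0 K; first by rewrite /K; lia.
  apply: (@le_trans _ _ (dotp (p * h K) (p * h K))).
    rewrite (dotpE _ _ (N + size (p * h K))) ?leq_addl // big_split_ord /=.
    rewrite -[leLHS]addr0 lerD //.
      by apply: ler_sum => k _; rewrite coefM_bdiff ?expr2 // /K; have := ltn_ord k; lia.
    by apply: sumr_ge0 => k _; rewrite -expr2 sqr_ge0.
  rewrite -(dotp_revp p (h K) D sp) (dotpE _ _ (K + D)) // big_split_ord /=.
  have -> : \sum_(i < K) (revp D p * h K)`_i * (revp D p * h K)`_i = 1 + b ^+ 2.
    under eq_bigr do rewrite lowE ?ltn_ord //.
    have -> : K = (K - 2).+2 by rewrite /K; lia.
    rewrite !big_ord_recl big1 => [|i _]; last by rewrite /= mulr0 subr0 mulr0.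
    by rewrite /= expr2; ring.
  have : \sum_(i < D) (revp D p * h K)`_(K + i) * (revp D p * h K)`_(K + i) <= 1 / 2.
    apply: (@le_trans _ _ (\sum_(i < D) (2 * D%:R)^-1)).
      apply: ler_sum => i _; rewrite -expr2 -real_normK ?num_real //.
      have := hK (K + i)%N (leq_addr _ _) => h1.
      apply: le_trans (_ : _ <= (2 * D%:R)^-1 * 1) _; last by rewrite mulr1.
      by rewrite expr2 ler_pM //; apply: le_trans h1 _.
    by rewrite sumr_const card_ord -[X in X <= _]mulr_natr invfM -mulrA mulVf ?gt_eqF // mulr1; lra.
  lra.
have [M hM] := slow_integer_sequence b f b1 b33 fsum.
have f0 : f 0%N = P`_0.
  by rewrite /f /conv big_ord_recl big_ord0 addr0 a00 mulr1.
pose F := \poly_(i < M) f i.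
(* Since a inverts the reversal and f is eventually zero, F is the quotient of P by its reversal;
   equal sizes will make it constant. *)
have FE : revp D P * F = P.
  apply/polyP => k; pose A := \poly_(i < k.+1) a i.
  have AE (q : {poly int}) i : (i <= k)%N -> (q * A)`_i = conv q a i.
    move=> ik; rewrite coefM; apply: eq_bigr => j _.
    by rewrite coef_poly ltnS (leq_trans (leq_subr _ _)).
  rewrite (coefM_agree _ _ (P * A)); last first.
    move=> i ik; rewrite AE // coef_poly; case: ltnP => // Mi; rewrite -/f hM //.
  rewrite mulrCA (coefM_agree _ _ 1) ?mulr1 // => i ik.
  by rewrite AE // aP coef1.
have P_neq0 : P != 0 by rewrite -size_poly_eq0 sP.
have F0 : F != 0 by apply: contra_neq P_neq0 => F0; rewrite -FE F0 mulr0.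
have sPr : size (revp D P) = D.+1.
  by rewrite /revp size_poly_eq // subnn.
have sF : size F = 1%N.
  have := congr1 (size : {poly int} -> nat) FE.
  rewrite size_mul // ?sP ?sPr; last by rewrite -size_poly_eq0 sPr.
  have : size F != 0%N by rewrite size_poly_eq0.
  by case: (size F) => [|[|s]] //= _; rewrite ?addSn ?addnS /=; lia.
have [r r0 Fr] : exists2 r, r != 0 & F = r%:P.
  by move/eqP: sF => /size_poly1P [r r0 ->]; exists r.
have pE : p = r%:~R *: revp D p.
  by rewrite /p -{1}FE Fr rmorphM /= map_polyC /= map_revp mulrC mul_polyC.
(* With a 0 = 1, d is zero exactly when b + 1/b = a 1. For a 1 <= 2 the second factor is at least (b
   - 1)^2, for a 1 >= 3 it is negative. *)
pose d := `|r%:~R * (1 - b * bdiff b a 1)|.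
have d0 : 0 < d.
  rewrite normr_gt0 mulf_neq0 ?intr_eq0 // /bdiff a00 /=.
  have [a1|a1] := leP (a 1%N) 2.
    have : (a 1%N)%:~R <= 2%:~R :> R by rewrite ler_int.
    move=> a1R; apply/lt0r_neq0.
    have : b * (a 1%N)%:~R <= b * 2 by rewrite ler_wpM2l //; lra.
    have : 0 < (b - 1) ^+ 2 by rewrite exprn_gt0 //; lra.
    rewrite expr2; lra.
  have : 3%:~R <= (a 1%N)%:~R :> R by rewrite ler_int.
  move=> a1R; apply/ltr0_neq0.
  have : b * 3 <= b * (a 1%N)%:~R by rewrite ler_wpM2l //; lra.
  move: b2; rewrite expr2; lra.
pose e := Num.min 1 (d / (2 * D%:R)).
have e0 : 0 < e by rewrite lt_min ltr01 divr_gt0 // mulr_gt0.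
have [K0 hK0] := coef_tail (revp D p) (bdiff b a) D srev h0 _ e0.
pose K := (K0 + D + D)%N.
have [|hK hKD] := hK0 K; first by rewrite /K; lia.
(* The second argument is 1 - bX up to degree K, while the first starts at degree D >= 2, so only
   the D terms beyond K count. By adjunction and p = r [revp D p], the modulus of this product is
   also d, a contradiction. *)
have : `|dotp ('X^D * h K) (revp D p * h K)| <= d / 2.
  rewrite dotpC (dotpE _ _ (K + D)) // big_split_ord /= big1 ?add0r; last first.
    move=> i _; rewrite lowE // coefXnM; case: ltnP => [_|Di]; first by rewrite mulr0.
    have [-> ->] : (i == 0 :> nat) = false /\ (i == 1 :> nat) = false by split; apply/eqP; lia.
    by rewrite mulr0 subr0 mul0r.
  apply: le_trans (ler_norm_sum _ _ _) _.
  apply: (@le_trans _ _ (\sum_(i < D) d / (2 * D%:R))).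
    apply: ler_sum => i _; rewrite normrM coefXnM.
    have -> : (K + i < D)%N = false by apply/negP; rewrite /K; lia.
    apply: (@le_trans _ _ (1 * (d / (2 * D%:R)))); last by rewrite mul1r.
    have h1 := hK (K + i)%N (leq_addr _ _).
    have h2 : `|(h K)`_(K + i - D)| <= e by apply: hKD; lia.
    by move: h1 h2; rewrite le_min => /andP[? _]; rewrite le_min => /andP[_ ?]; apply: ler_pM.
  rewrite sumr_const card_ord -[X in X <= _]mulr_natr invfM -!mulrA mulVf ?gt_eqF // mulr1 //.
rewrite (dotp_revp_adjoint p (h K) (h K) D sp) pE -scalerAl dotpZl (dotpC (_ * _)) (dotpE _ _ K) ?size_poly //.
have -> : \sum_(i < K) (h K)`_i * (revp D p * h K)`_i = 1 - b * bdiff b a 1.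
  under eq_bigr do rewrite lowE ?ltn_ord //.
  have -> : K = (K - 2).+2 by rewrite /K; lia.
  rewrite !big_ord_recl big1 => [|i _]; last by rewrite /= mulr0 subr0 mulr0.
  have h1 : (h (K - 2).+2)`_0 = 1 by rewrite /h coef_poly /= /bdiff a00 mulr0 subr0.
  have h2 : (h (K - 2).+2)`_1 = bdiff b a 1 by rewrite /h coef_poly.
  by rewrite /= /bump /= h1 h2; move: (bdiff b a 1) => y; ring.
rewrite -/d; lra.
Qed.

(** * Small differences of binary values *)

Lemma minimal_monic_coef0 {R : realType} (b : R) (P : {poly int}) :
  1 < b -> minimal_monic b P -> P`_0 != 0.
Proof.
move=> b1 [mP Pb minP]; apply/negP => /eqP P0.
pose Q := \poly_(i < (size P).-1) P`_i.+1.
have PE : P = 'X^1 * Q.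
  apply/polyP => -[|i]; rewrite coefXnM //= subn1 /= coef_poly.
  by case: ltnP => // Pi; rewrite nth_default //; move: Pi; case: (size P).
have Q0 : Q != 0.
  by apply: contraTneq mP => Q0; rewrite PE Q0 mulr0 monicE lead_coef0 eq_sym oner_eq0.
have := minP Q Q0; have -> : evalz b Q = 0.
  move: Pb; rewrite PE rmorphM /= evalzXn expr1 => /eqP.
  by rewrite mulf_eq0 (gt_eqF (lt_trans ltr01 b1)) => /eqP.
move=> /(_ erefl); have := size_poly (size P).-1 (fun i => P`_i.+1); rewrite -/Q.
have : size P != 0%N by rewrite size_poly_eq0 monic_neq0.
by move: (size P) (size Q) => x y; lia.
Qed.

(** A monic polynomial of degree 1 would make b an integer strictly between 1 and 2. *)
Lemma minimal_monic_size {R : realType} (b : R) (P : {poly int}) :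
  1 < b -> b < 2 -> minimal_monic b P -> (3 <= size P)%N.
Proof.
move=> b1 b2 [mP Pb _]; rewrite ltnNge; apply/negP => sP.
have : evalz b P = \sum_(i < 2) (P`_i)%:~R * b ^+ i by rewrite (evalzE b P 2).
rewrite Pb !big_ord_recl big_ord0 /= expr0 expr1 mulr1 addr0 /bump /=.
have s0 : size P != 0%N by rewrite size_poly_eq0 monic_neq0.
have lP : P`_(size P).-1 = 1 by apply/eqP; rewrite -lead_coefE -monicE.
have [s1|s2] : size P = 1%N \/ size P = 2%N by move: (size P) sP s0 => x; lia.
- move: lP; rewrite s1 /= => ->; rewrite (nth_default 0) ?s1 // mul0r addr0 => /eqP.
  by rewrite eq_sym oner_eq0.
- move: lP; rewrite s2 /= => ->; rewrite mul1r => /eqP.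
  rewrite eq_sym addrC addr_eq0 -rmorphN /= => /eqP bE.
  move: b1 b2; rewrite bE -[1]/(1%:~R) -[2]/(2%:~R) !ltr_int; lia.
Qed.

(** That X^k P has [topcoef] 0 is the linear recurrence with characteristic polynomial P; the
    initial values 0, ..., 0, 1 turn it into the power series inverse of the reversal. *)
Lemma conv_topcoef (R : realType) (b : R) (P : {poly int}) k : minimal_monic b P -> (3 <= size P)%N ->
  conv (revp (size P).-1 P) (fun k => topcoef P 'X^(k + (size P).-2)) k = (k == 0%N)%:R.
Proof.
move=> mmP P3; have [mP Pb _] := mmP; set D := (size P).-1.
have DE : D = (size P).-2.+1 by rewrite /D; case: (size P) P3 => [|[]].
have PD : P`_D = 1 by have := mP; rewrite monicE lead_coefE => /eqP.
pose t i := topcoef P 'X^i.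
have t_small i : (i < (size P).-2)%N -> t i = 0.
  by move=> iD; rewrite /t topcoef_Xn ?ltn_eqF // -/D DE leqW.
case: k => [|k].
  rewrite /conv big_ord_recl big_ord0 addr0 coef_revp subn0 PD mul1r add0n.
  by rewrite topcoef_Xn ?eqxx // -/D DE.
rewrite /= /conv.
(* Extended by zeros, the sum may be cut either at k + 1, as in [conv], or at the degree D of the
   reversal, as in the recurrence. *)
pose G j := (revp D P)`_j * (if (j <= k.+1)%N then t (k.+1 - j + (size P).-2)%N else 0).
transitivity (\sum_(j < k.+2 + D) G j).
  rewrite big_split_ord /= [X in _ = _ + X]big1 ?addr0 => [|j _].
    by apply: eq_bigr => j _; rewrite /G -ltnS ltn_ord.
  by rewrite /G leqNgt addSn ltnS leq_addr mulr0.
transitivity (\sum_(j < D.+1 + k.+1) G j); first by rewrite addSnnS addnC.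
rewrite big_split_ord /= [X in _ + X]big1 ?addr0 => [|j _]; last first.
  by rewrite /G coef_revp leqNgt addSn ltnS leq_addr mul0r.
rewrite (reindex_inj rev_ord_inj) /=.
have : topcoef P ('X^k * P) = 0 by rewrite (topcoef_dvd b) // rmorphM /= Pb mulr0.
rewrite (topcoef_lin _ _ (k + D.+1)) //; last first.
  by rewrite size_XnM_leq // /D; case: (size P) P3.
rewrite big_split_ord /= big1 ?add0r => [E|j _]; last by rewrite coefXnM ltn_ord mul0r.
rewrite -[RHS]E; apply: eq_bigr => j _; have jD : (j <= D)%N by rewrite -ltnS.
rewrite /G coef_revp subSS leq_subr subKn // coefXnM ltnNge leq_addr /= addKn.
case: leqP => Djk; last by rewrite mulr0 -/(t _) t_small ?mulr0 //; move: DE jD Djk; move: (D) (size P).-2 (nat_of_ord j); clear; lia.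
congr (_ * topcoef P 'X^_); move: DE jD Djk; move: (D) (size P).-2 (nat_of_ord j); clear; lia.
Qed.

Lemma small_differences {R : realType} (b e : R) : 1 < b -> b <= 33%:R / 32%:R -> 0 < e ->
  exists p q : {poly int}, [/\ binary p, binary q & 0 < evalz b p - evalz b q < e].
Proof.
move=> b1 b33 e0; apply: contrapT => no.
have gap : gapped b e.
  move=> p q bp bq; have [|pq] := eqVneq (evalz b p) (evalz b q); [by left|right].
  rewrite leNgt; apply/negP => pqe; apply: no.
  move: pq; rewrite neq_lt => /orP[pq|pq]; [exists q, p|exists p, q]; split => //.
  - by rewrite subr_gt0 pq; move: pqe; rewrite distrC gtr0_norm ?subr_gt0.
  - by rewrite subr_gt0 pq; move: pqe; rewrite gtr0_norm ?subr_gt0.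
have b11 : b <= 11%:R / 10%:R by lra.
have [P mmP] := gapped_monic b e b1 b11 e0 gap.
have P3 : (3 <= size P)%N by apply: (minimal_monic_size b) => //; lra.
have PD : P`_(size P).-1 = 1 by case: mmP => + _ _; rewrite monicE lead_coefE => /eqP.
apply: (@siegel _ b P (fun k => topcoef P 'X^(k + (size P).-2)) (size P).-1) => //.
- by case: (size P) P3.
- by case: (size P) P3.
- exact: minimal_monic_coef0 mmP.
- by move=> k; exact: conv_topcoef mmP P3.
- move=> d /(topcoef_vanish b e P b1 b11 e0 gap mmP)[M hM]; exists M => k Mk.
  by rewrite addSn; apply: hM; rewrite (leq_trans Mk) // leq_addr.
Qed.

(** * The weight game *)

(** One link is added at a time: all old polynomials receive the high digits X^s q, and the new last
    one is the old last one with X^s p instead. *)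
Lemma chain {R : realType} (b e : R) r : 1 < b -> b <= 33%:R / 32%:R -> 0 < e ->
  exists Q (c : nat -> {poly int}),
    (forall t, (t <= r)%N -> binary (c t) /\ (size (c t) <= Q)%N) /\
    (forall t, (t < r)%N -> e / 2 < evalz b (c t.+1) - evalz b (c t) <= e).
Proof.
move=> b1 b33 e0; elim: r => [|r [Q [c [cQ ce]]]].
  by exists 0%N, (fun=> 0); split => // t _; split; [exact: binary0|rewrite size_poly0].
have bQ : 0 < b ^+ Q by rewrite exprn_gt0 //; lra.
(* For so small a difference z, the least s with b^s z > e / 2 exceeds Q, so X^s lies above all
   digits in use; minimality and b <= 2 give b^s z <= e. *)
have [p [q [bp bq /andP[pq0 pqe]]]] := small_differences b (e / 2 / b ^+ Q) b1 b33 (divr_gt0 (divr_gt0 e0 (ltr0Sn _ 1)) bQ).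
set z := evalz b p - evalz b q in pq0 pqe.
pose A s := e / 2 < b ^+ s * z.
have [|s As mins] := @ex_minnP A.
  have [s hs] := expr_unbounded b (e / z) b1; exists s; rewrite /A.
  by rewrite -ltr_pdivrMr // (lt_le_trans _ hs) // ltr_pM2r ?invr_gt0 //; lra.
have Qs : (Q < s)%N.
  rewrite ltnNge; apply/negP => sQ.
  have : b ^+ s * z <= b ^+ Q * z by rewrite ler_wpM2r ?(ltW pq0) // ler_weXn2l // ltW.
  by move: As pqe; rewrite /A ltr_pdivlMr // mulrC; lra.
have zs : b ^+ s * z <= e.
  case: s As mins Qs => [//|s] As mins Qs.
  have : ~~ A s by apply/negP => /mins; rewrite ltnn.
  rewrite /A -leNgt => h.
  have : b * (b ^+ s * z) <= b * (e / 2) by rewrite ler_wpM2l //; lra.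
  have : b * (e / 2) <= 2 * (e / 2) by rewrite ler_wpM2r //; lra.
  by rewrite exprS -mulrA; lra.
pose c' t := if (t <= r)%N then c t + 'X^s * q else c r + 'X^s * p.
have cs t : (t <= r)%N -> (size (c t) <= s)%N.
  by move=> tr; have [_ h] := cQ t tr; rewrite (leq_trans h) // ltnW.
exists (s + maxn (size p) (size q))%N, c'; split => t tr; rewrite /c'.
- case: ifP => tr'.
  + have [bc _] := cQ t tr'; split; first by apply: binary_cat => //; exact: cs.
    rewrite (leq_trans (size_polyD _ _)) // geq_max (leq_trans (cs _ tr')) ?leq_addr //=.
    by rewrite size_XnM_leq // leq_maxr.
  + have [bc _] := cQ r (leqnn r); split; first by apply: binary_cat => //; exact: cs.
    rewrite (leq_trans (size_polyD _ _)) // geq_max (leq_trans (cs _ (leqnn r))) ?leq_addr //=.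
    by rewrite size_XnM_leq // leq_maxl.
- rewrite ltnS in tr; rewrite tr; case: ltnP => tr'.
  + have := ce t tr'; rewrite !rmorphD /=; lra.
  + have -> : t = r by apply/eqP; rewrite eqn_leq tr.
    rewrite !rmorphD !rmorphM /= !evalzXn.
    by move: As zs; rewrite /A /z mulrBr; lra.
Qed.

Lemma chain_hit {R : realType} (v : nat -> R) (e x : R) N :
  (forall t, (t < N)%N -> v t.+1 - v t <= e) -> 0 <= e -> v 0%N <= x <= v N ->
  exists2 t, (t <= N)%N & `|v t - x| <= e.
Proof.
move=> ve e0; elim: N ve => [|N IH] ve /andP[v0 vN].
  by exists 0%N => //; rewrite ler_norml; lra.
have [xN|xN] := leP x (v N).
  have [t tN|t tN ht] := IH _ (introT andP (conj v0 xN)); first by apply: ve; exact: leqW.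
  by exists t => //; exact: leqW.
by exists N.+1 => //; have := ve N (ltnSn N); rewrite ler_norml; lra.
Qed.

Lemma chain_length {R : realType} (v : nat -> R) (e : R) N :
  (forall t, (t < N)%N -> e <= v t.+1 - v t) ->
  forall s t, (s + t <= N)%N -> t%:R * e <= v (s + t)%N - v s.
Proof.
move=> ve s; elim=> [|t IH] st; first by rewrite addn0 mul0r subrr.
rewrite addnS in st *.
by have := ve _ st; have := IH (ltnW st); rewrite -natr1; lra.
Qed.

Definition step {R : realType} {n : nat} (b : R) (x : 'I_n.+1 -> R) (i : 'I_n.+1) :
  'I_n.+1 -> R := fun j => b * x j - (j == i)%:R.

Definition run {R : realType} {n : nat} (b : R) (x : 'I_n.+1 -> R) (u : seq 'I_n.+1) :=
  foldl (step b) x u.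

Lemma run_cat {R : realType} n (b : R) (x : 'I_n.+1 -> R) u v :
  run b x (u ++ v) = run b (run b x u) v.
Proof. exact: foldl_cat. Qed.

Lemma run_diff {R : realType} n (b : R) (x y : 'I_n.+1 -> R) u j :
  run b x u j - run b y u j = b ^+ size u * (x j - y j).
Proof.
elim: u x y => [|i u IH] x y /=; first by rewrite expr0 mul1r.
by rewrite IH /step exprSr; ring.
Qed.

Lemma run_sum {R : realType} n (b : R) (x : 'I_n.+1 -> R) u : b != 1 ->
  \sum_j x j = (b - 1)^-1 -> \sum_j run b x u j = (b - 1)^-1.
Proof.
move=> b1; elim: u x => [//|i u IH] x sx /=; apply: IH.
rewrite /step sumrB -mulr_sumr sx (bigD1 i) //= eqxx mulr1n big1 ?addr0.
  by field; rewrite subr_eq0.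
by move=> j /negbTE ->.
Qed.

Lemma run_ge {R : realType} n (b : R) (x : 'I_n.+1 -> R) u j : 1 <= b ->
  (size u)%:R <= x j -> x j - (size u)%:R <= run b x u j.
Proof.
move=> b1; elim: u x => [|i u IH] x /=; first by rewrite subr0.
rewrite -natr1 => ux; have u0 : 0 <= (size u)%:R :> R by [].
have h : x j - 1 <= step b x i j.
  rewrite /step; have : 0 <= (b - 1) * x j by apply: mulr_ge0; lra.
  by case: (j == i) => /=; lra.
by apply: le_trans (IH _ _); lra.
Qed.

Lemma exists_ge_mean {R : realType} n (x : 'I_n.+1 -> R) (th : R) :
  \sum_j x j = n.+1%:R * th -> exists i, th <= x i.
Proof.
move=> sx; apply: contrapT => no.
have : \sum_j x j < \sum_(j < n.+1) th.
  apply: ltr_sum => [|i _]; first by apply/hasP; exists ord0; rewrite ?mem_index_enum.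
  by rewrite ltNge; apply/negP => h; apply: no; exists i.
by rewrite sx sumr_const card_ord -(mulr_natl th) ltxx.
Qed.

Lemma exists_le_mean {R : realType} n (x : 'I_n.+1 -> R) (th : R) :
  \sum_j x j = n.+1%:R * th -> exists i, x i <= th.
Proof.
move=> sx; have [|i] := @exists_ge_mean _ n (fun j => - x j) (- th).
  by rewrite sumrN sx mulrN.
by rewrite lerN2; exists i.
Qed.

(** The letter played always has a coordinate at least the mean th, so that it keeps b th - 1 >= th
    - 1. The other coordinates are multiplied by b. *)
Lemma balance {R : realType} n (b th : R) (x : 'I_n.+1 -> R) k :
  1 < b -> 1 <= th -> n.+1%:R * th = (b - 1)^-1 -> \sum_j x j = (b - 1)^-1 ->
  exists u, size u = k /\
    forall j, th - 1 <= run b x u j \/ b ^+ k * x j <= run b x u j.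
Proof.
move=> b1 th1 thE sx; elim: k => [|k [u [su hu]]].
  by exists [::]; split => // j; right; rewrite expr0 mul1r.
have [i hi] : exists i, th <= run b x u i.
  by apply: exists_ge_mean; rewrite run_sum // gt_eqF.
exists (rcons u i); split; first by rewrite size_rcons su.
move=> j; rewrite -cats1 run_cat /= /step.
have bth : 0 <= (b - 1) * (th - 1) by apply: mulr_ge0; lra.
have [->|ji] := eqVneq j i.
  left; have : b * th <= b * run b x u i by rewrite ler_wpM2l //; lra.
  by move=> ?; rewrite mulr1n; lra.
rewrite subr0; case: (hu j) => h.
  left; have : b * (th - 1) <= b * run b x u j by rewrite ler_wpM2l //; lra.
  lra.
by right; rewrite exprS -mulrA ler_wpM2l //; lra.
Qed.

Lemma steer_center {R : realType} n (b th : R) (x : 'I_n.+1 -> R) :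
  1 < b -> 1 <= th -> n.+1%:R * th = (b - 1)^-1 -> \sum_j x j = (b - 1)^-1 ->
  (forall j, 0 < x j) -> exists u, forall j, th - 1 <= run b x u j.
Proof.
move=> b1 th1 thE sx x0.
have /choice [k hk] : forall j, exists k, th / x j <= b ^+ k by move=> j; exact: expr_unbounded.
have [u [_ hu]] := balance n b th x (\max_j k j) b1 th1 thE sx.
exists u => j; case: (hu j) => // h; apply: le_trans h.
have : b ^+ k j <= b ^+ (\max_j k j) by rewrite ler_weXn2l ?leq_bigmax // ltW.
have := hk j; rewrite ler_pdivrMr // => h1 h2.
have : b ^+ k j * x j <= b ^+ (\max_j k j) * x j by rewrite ler_wpM2r // ltW.
lra.
Qed.

Definition unstep {R : realType} {n : nat} (b : R) (z : 'I_n.+1 -> R) (i : 'I_n.+1) :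
  'I_n.+1 -> R := fun j => (z j + (j == i)%:R) / b.

Lemma unstepK {R : realType} n (b : R) (z : 'I_n.+1 -> R) i : 0 < b ->
  step b (unstep b z i) i = z.
Proof.
by move=> b0; apply/funext => j; rewrite /step /unstep [b * _]mulrC divfK ?addrK // gt_eqF.
Qed.

Lemma unstep_sum {R : realType} n (b : R) (z : 'I_n.+1 -> R) i : 1 < b ->
  \sum_j z j = (b - 1)^-1 -> \sum_j unstep b z i j = (b - 1)^-1.
Proof.
move=> b1 sz; have b0 : 0 < b := lt_trans ltr01 b1.
rewrite -mulr_suml big_split /= sz (bigD1 i) //= eqxx mulr1n big1 ?addr0.
  by field; rewrite subr_eq0 !gt_eqF.
by move=> j /negbTE ->.
Qed.

(** The letter undone has a coordinate at most the mean th, which becomes at most th + 1. The other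
    coordinates are divided by b. *)
Lemma backward_balance {R : realType} n (b th : R) (y : 'I_n.+1 -> R) k :
  1 < b -> 0 <= th -> n.+1%:R * th = (b - 1)^-1 -> \sum_j y j = (b - 1)^-1 ->
  exists v z, [/\ run b z v = y, \sum_j z j = (b - 1)^-1 &
    forall j, z j <= th + 1 \/ b ^+ k * z j <= y j].
Proof.
move=> b1 th0 thE sy; elim: k => [|k [v [z [vz sz hz]]]].
  by exists [::], y; split => // j; right; rewrite expr0 mul1r.
have [i hi] : exists i, z i <= th by apply: exists_le_mean; rewrite sz.
have b0 : 0 < b := lt_trans ltr01 b1.
exists (i :: v), (unstep b z i); split.
- by rewrite /= unstepK.
- exact: unstep_sum.
- move=> j; have bth : 0 <= (b - 1) * (th + 1) by apply: mulr_ge0; lra.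
  have le1 : z j + (j == i)%:R <= th + 1 -> unstep b z i j <= th + 1.
    by move=> h; rewrite /unstep ler_pdivrMr //; lra.
  have [ji|ji] := eqVneq j i; first by left; apply: le1; rewrite ji eqxx mulr1n; lra.
  case: (hz j) => h; first by left; apply: le1; rewrite (negbTE ji) addr0.
  by right; rewrite exprSr -mulrA /unstep (negbTE ji) addr0 [b * _]mulrC divfK // gt_eqF.
Qed.

(** After enough backward moves all coordinates are at most th + 1; the fixed sum (n + 1) th then
    gives the lower bound. *)
Lemma central_preimage {R : realType} n (b th : R) (y : 'I_n.+1 -> R) :
  1 < b -> 0 <= th -> n.+1%:R * th = (b - 1)^-1 -> \sum_j y j = (b - 1)^-1 ->
  exists v z, [/\ run b z v = y, \sum_j z j = (b - 1)^-1 &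
    forall j, th - n%:R <= z j <= th + 1].
Proof.
move=> b1 th0 thE sy.
have /choice [k hk] : forall j, exists k, y j <= b ^+ k by move=> j; exact: expr_unbounded.
have [v [z [vz sz hz]]] := backward_balance n b th y (\max_j k j) b1 th0 thE sy.
have b0 : 0 < b := lt_trans ltr01 b1.
have zth j : z j <= th + 1.
  case: (hz j) => // h.
  have h2 : b ^+ k j <= b ^+ (\max_j k j) by rewrite ler_weXn2l ?leq_bigmax // ltW.
  have : b ^+ (\max_j k j) * z j <= b ^+ (\max_j k j) * 1 by rewrite mulr1; have := hk j; lra.
  by rewrite ler_pM2l ?exprn_gt0 //; lra.
exists v, z; split => // j; rewrite zth andbT.
have : \sum_(i | i != j) z i <= \sum_(i < n.+1 | i != j) (th + 1).
  by apply: ler_sum => i _; exact: zth.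
rewrite sumr_const cardC1 card_ord /= -(mulr_natl (th + 1)).
move: sz thE; rewrite (bigD1 j) //= -natr1; lra.
Qed.

(** * Rounds *)

(** Turn k is reserved for the choice between the letters 0 and k + 1; [inord] has its intended
    value for k < n. *)
Definition fineword {n : nat} (d : nat -> bool) (m : nat) : seq 'I_n.+1 :=
  [seq if d k then inord k.+1 else ord0 | k <- iota 0 m].

Lemma size_fineword n d m : size (@fineword n d m) = m.
Proof. by rewrite size_map size_iota. Qed.

Lemma run_fineword {R : realType} n (b : R) (x : 'I_n.+1 -> R) d m (j : 'I_n.+1) :
  (m <= n)%N -> j != ord0 ->
  run b x (fineword d m) j =
  b ^+ m * x j - (if (j <= m)%N then (d j.-1)%:R * b ^+ (m - j) else 0).
Proof.
move=> + j0; have j1 : (0 < j)%N by rewrite lt0n.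
elim: m => [|m IH] mn.
  by rewrite expr0 mul1r leqNgt j1 subr0.
have fwS : fineword d m.+1 = fineword d m ++ [:: if d m then inord m.+1 else ord0] :> seq 'I_n.+1.
  by rewrite /fineword -[in iota 0 m.+1](addn1 m) iotaD map_cat.
rewrite fwS run_cat /= /step (IH (ltnW mn)).
have -> : (j == (if d m then inord m.+1 else ord0)) = (j == m.+1 :> nat) && d m.
  case: (d m); last by rewrite andbF (negbTE j0).
  by rewrite andbT -val_eqE /= inordK.
rewrite exprS; case: (ltngtP j m.+1) => [jm|jm|jm].
- rewrite ltnS in jm; rewrite jm subSn // exprS /= subr0; ring.
- by rewrite leqNgt (ltn_trans (ltnSn m) jm) /= !subr0 mulrA.
- by rewrite jm ltnn subnn expr0 mulr1 subr0 mulrA.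
Qed.

(* The polynomial [c k] holds, most significant digit first, the choices between the
   letters [0] and [k + 1] made in the successive rounds; [cws] holds the control words
   which complete these rounds. *)
Fixpoint mword {n : nat} (c : nat -> {poly int}) (cws : seq (seq 'I_n.+1)) : seq 'I_n.+1 :=
  if cws is cw :: cws' then
    fineword (fun k => (c k)`_(size cws') == 1) n ++ cw ++ mword c cws'
  else [::].

(** With common control words, the choices for letter j act on coordinate j alone among the nonzero
    ones, as the digits of a number in base g = b^(n + L), where n + L is the length of a round. *)
Lemma mword_diff {R : realType} n (b : R) L (c c' : nat -> {poly int}) (cws : seq (seq 'I_n.+1))
    (x x' : 'I_n.+1 -> R) (j : 'I_n.+1) :
  (forall k, binary (c k)) -> (forall k, binary (c' k)) ->
  (forall cw, cw \in cws -> size cw = L) -> j != ord0 ->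
  run b x (mword c cws) j - run b x' (mword c' cws) j =
  (b ^+ (n + L)) ^+ size cws * (x j - x' j) -
  b ^+ (n + L - j) * \sum_(i < size cws) ((c j.-1)`_i - (c' j.-1)`_i)%:~R * (b ^+ (n + L)) ^+ i.
Proof.
move=> bc bc' + j0; have jn : (j <= n)%N by rewrite -ltnS.
elim: cws x x' => [|cw cws IH] x x' hL /=.
  by rewrite big_ord0 mulr0 subr0 expr0 mul1r.
rewrite !run_cat IH; last by move=> w wc; apply: hL; rewrite inE wc orbT.
rewrite run_diff !run_fineword // jn hL ?mem_head // big_ord_recr /=.
have bit (q : {poly int}) i : binary q -> (q`_i == 1)%:R = (q`_i)%:~R :> R.
  by move=> bq; case/orP: (bq i) => /eqP ->.
rewrite !bit // intrB (_ : b ^+ (n + L - j) = b ^+ (n - j) * b ^+ L); last by rewrite -exprD addnBAC.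
rewrite exprS; set g := (b ^+ (n + L)) ^+ _; set S := \sum_(i < _) _.
rewrite exprD; ring.
Qed.

(** The n reserved turns cost at most n. Since (b - 1) (n + 1) th = 1, balancing for 2 (n + 1)^2
    turns gains about 2 (n + 1), which more than repays them. *)
Lemma control {R : realType} n (b th : R) (x : 'I_n.+1 -> R) d :
  1 < b -> n.+1%:R * th = (b - 1)^-1 -> (b - 1) * n.+1%:R ^+ 3 <= 1 / 2 ->
  \sum_j x j = (b - 1)^-1 -> (forall j, th - 1 <= x j) ->
  exists cw, size cw = (2 * n.+1 ^ 2)%N /\
    forall j, th - 1 <= run b x (fineword d n ++ cw) j.
Proof.
move=> b1 thE bn sx xth; set N : R := n.+1%:R; set L := (2 * n.+1 ^ 2)%N.
have N1 : 1 <= N by rewrite ler1n.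
have N0 : N = n%:R + 1 by rewrite /N -natr1.
have LE : L%:R = 2 * N ^+ 2 :> R by rewrite /L natrM natrX.
have thbE : (b - 1) * (N * th) = 1 by rewrite thE mulfV // subr_eq0 gt_eqF.
have N2 : 1 <= N ^+ 2 by rewrite exprn_ege1.
have NN2 : N <= N ^+ 2 by rewrite expr2; have : 0 <= (N - 1) * N; [apply: mulr_ge0|]; lra.
have bN0 : 0 < (b - 1) * N by apply: mulr_gt0; lra.
have th2 : 2 * N ^+ 2 <= th.
  rewrite -(ler_pM2l bN0) -[leRHS]mulrA thbE; move: bn; rewrite exprSr; lra.
pose y := run b x (fineword d n).
have yth j : th - N <= y j.
  have h := xth j; have := @run_ge _ n b x (fineword d n) j (ltW b1); rewrite size_fineword.
  rewrite -/y N0 => /(_ _) hy; apply: le_trans (hy _); lra.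
have sy : \sum_j y j = (b - 1)^-1 by rewrite run_sum // gt_eqF.
have [|cw [scw hcw]] := balance n b th y L b1 _ thE sy; first lra.
exists cw; split => // j; rewrite run_cat; case: (hcw j) => // h; apply: le_trans h.
have bL := bernoulli b L b1.
have h1 : (1 + L%:R * (b - 1)) * (th - N) <= b ^+ L * y j.
  apply: ler_pM => //; [|lra]; rewrite LE.
  by have : 0 <= (b - 1) * N ^+ 2; [apply: mulr_ge0|]; lra.
apply: le_trans h1; rewrite LE.
have -> : (1 + 2 * N ^+ 2 * (b - 1)) * (th - N) =
    th - N + 2 * N * ((b - 1) * (N * th)) - 2 * ((b - 1) * N ^+ 3) by ring.
by rewrite thbE; move: bn; rewrite -/N; lra.
Qed.

Lemma control_rounds {R : realType} n (b th : R) (x : 'I_n.+1 -> R) (c : nat -> {poly int}) K :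
  1 < b -> n.+1%:R * th = (b - 1)^-1 -> (b - 1) * n.+1%:R ^+ 3 <= 1 / 2 ->
  \sum_j x j = (b - 1)^-1 -> (forall j, th - 1 <= x j) ->
  exists cws : seq (seq 'I_n.+1), [/\ size cws = K,
    forall cw, cw \in cws -> size cw = (2 * n.+1 ^ 2)%N &
    forall j, th - 1 <= run b x (mword c cws) j].
Proof.
move=> b1 thE bn; elim: K x => [|K IH] x sx xth; first by exists [::].
have [cw [scw hcw]] := control n b th x (fun k => (c k)`_K == 1) b1 thE bn sx xth.
have [|cws [scws hcws hr]] := IH _ _ hcw; first by rewrite run_sum // gt_eqF.
exists (cw :: cws); split.
- by rewrite /= scws.
- by move=> w; rewrite inE => /orP[/eqP ->|]; [|exact: hcws].
- by move=> j /=; rewrite scws catA run_cat.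
Qed.

Lemma upper_of_lower {R : realType} n (th : R) (x : 'I_n.+1 -> R) j :
  \sum_j x j = n.+1%:R * th -> (forall j, th - 1 <= x j) -> x j <= th + n%:R.
Proof.
move=> sx xth.
have : \sum_(i < n.+1 | i != j) (th - 1) <= \sum_(i | i != j) x i.
  by apply: ler_sum => i _; exact: xth.
rewrite sumr_const cardC1 card_ord /= -(mulr_natl (th - 1)).
move: sx; rewrite (bigD1 j) //= -natr1; lra.
Qed.

(** The number of turns in one round: n reserved ones and a control word. *)
Definition rounds (n : nat) : nat := (n + 2 * n.+1 ^ 2)%N.

(** A reference play, with the middle of a chain as choices for every letter, ends within 2 (n + 1)
    of z. The control words are then kept, and the choices for each letter j replaced by the chain
    element that corrects coordinate j. Coordinate 0 follows from the sum. *)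
Lemma fine_steer {R : realType} n (b th eta : R) (x z : 'I_n.+1 -> R) :
  1 < b -> b ^+ rounds n <= 33%:R / 32%:R -> n.+1%:R * th = (b - 1)^-1 ->
  (b - 1) * n.+1%:R ^+ 3 <= 1 / 2 ->
  \sum_j x j = (b - 1)^-1 -> (forall j, th - 1 <= x j) ->
  \sum_j z j = (b - 1)^-1 -> (forall j, th - n%:R <= z j <= th + 1) -> 0 < eta ->
  exists u, forall j, `|run b x u j - z j| <= eta.
Proof.
move=> b1 g33 thE bn sx xth sz zth eta0.
set g := b ^+ rounds n in g33; have g1 : 1 < g by rewrite /g exprn_egt1 // -lt0n addn_gt0 muln_gt0 expn_gt0 orbT.
set N : R := n.+1%:R; have N1 : 1 <= N by rewrite ler1n.
have N0 : N = n%:R + 1 by rewrite /N -natr1.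
have n0 : 0 <= n%:R :> R by [].
(* Since B j <= 2 the nonzero coordinates are off by at most 2 e; the n errors add up to at most eta
   in coordinate 0. *)
set e := eta / (2 * N); have e0 : 0 < e by rewrite divr_gt0 // mulr_gt0 //; lra.
(* Steps larger than e / 2 let a chain of length 2 r reach 2 N on both sides of its middle. *)
have [r hr] : exists r : nat, 2 * N <= r%:R * (e / 2).
  exists (Num.truncn (2 * N / (e / 2))).+1.
  by rewrite -ler_pdivrMr; [exact/ltW/truncnS_gt|lra].
have [Q [cc [ccQ cce]]] := chain g e (r + r) g1 g33 e0.
pose v t := evalz g (cc t).
have bcc t : (t <= r + r)%N -> binary (cc t) by move=> /ccQ[].
have brr : binary (cc r) by apply: bcc; rewrite leq_addr.
have [cws [scws hcws hy]] := control_rounds n b th x (fun=> cc r) Q b1 thE bn sx xth.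
set y := run b x (mword (fun=> cc r) cws) in hy.
have sy : \sum_j y j = (b - 1)^-1 by rewrite run_sum // gt_eqF.
have yz j : `|y j - z j| <= 2 * N.
  have := upper_of_lower n th y j; rewrite sy => /(_ (esym thE) hy).
  by have := hy j; have := zth j; rewrite ler_norml; lra.
pose B (j : 'I_n.+1) := b ^+ (rounds n - j).
have B1 j : 1 <= B j by rewrite exprn_ege1 // ltW.
have B2 j : B j <= 2.
  have : B j <= g by rewrite ler_weXn2l ?leq_subr // ltW.
  lra.
have /choice[t ht] : forall j, exists t, (t <= r + r)%N /\ `|v t - (v r + (y j - z j) / B j)| <= e.
  move=> j; have D : `|(y j - z j) / B j| <= 2 * N.
    rewrite normrM normfV (@ger0_norm _ (B j)); last by have := B1 j; lra.
    rewrite ler_pdivrMr; last by have := B1 j; lra.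
    by apply: le_trans (yz j) _; rewrite -[leLHS]mulr1 ler_wpM2l //; lra.
  have vlen := chain_length v (e / 2) (r + r) (fun t tr => ltW (proj1 (andP (cce t tr)))).
  have h1 := vlen 0%N r; have h2 := vlen r r.
  have [|t tr ht] := chain_hit v e (v r + (y j - z j) / B j) (r + r)
    (fun t tr => proj2 (andP (cce t tr))) (ltW e0); last by exists t.
  move: D h1 h2; rewrite add0n leq_addr leqnn ler_norml => D /(_ isT) h1 /(_ isT) h2; lra.
pose c' k := cc (t (inord k.+1)).
exists (mword c' cws).
have main j : j != ord0 -> `|run b x (mword c' cws) j - z j| <= 2 * e.
  move=> j0; have bc' k : binary (c' k) by apply: bcc; case: (ht (inord k.+1)).
  have := mword_diff n b _ (fun=> cc r) c' cws x x j (fun=> brr) bc' hcws j0.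
  have -> : c' j.-1 = cc (t j).
    by rewrite /c' prednK ?lt0n // inord_val.
  rewrite -/(rounds n) -/g -/y -/(B j) subrr mulr0 sub0r scws.
  have -> : \sum_(i < Q) ((cc r)`_i - (cc (t j))`_i)%:~R * g ^+ i = v r - v (t j).
    have [tj _] := ht j; rewrite /v !(evalzE g _ Q) ?(proj2 (ccQ _ _)) ?leq_addr //.
    by rewrite -sumrB; apply: eq_bigr => i _; rewrite intrB mulrBl.
  move=> E; have -> : run b x (mword c' cws) j - z j = - (B j * (v (t j) - (v r + (y j - z j) / B j))).
    have BD : B j * ((y j - z j) / B j) = y j - z j by rewrite mulrC divfK // gt_eqF //; have := B1 j; lra.
    by move: BD E; move: (_ / B j) => D; lra.
  have [_ h] := ht j; rewrite normrN normrM ger0_norm; last by have := B1 j; lra.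
  by apply: ler_pM => //; have := B1 j; lra.
have eN : 2 * e * N = eta by rewrite /e; field; lra.
move=> j; have [->|j0] := eqVneq j ord0; last first.
  apply: le_trans (main j j0) _; rewrite -eN -[leLHS]mulr1 ler_wpM2l //; lra.
set y' := run b x _ in main *.
have sy' : \sum_j y' j = (b - 1)^-1 by rewrite run_sum // gt_eqF.
have -> : y' ord0 - z ord0 = - \sum_(i | i != ord0) (y' i - z i).
  by rewrite sumrB; move: sy' sz; rewrite !(bigD1 ord0 (P := xpredT)) //=; lra.
rewrite normrN; apply: le_trans (ler_norm_sum _ _ _) _.
apply: (@le_trans _ _ (\sum_(i < n.+1 | i != ord0) (2 * e))); first by apply: ler_sum.
rewrite sumr_const cardC1 card_ord /= -(mulr_natl (2 * e)) -eN N0.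
lra.
Qed.

Lemma preimage_word {R : realType} n (b : R) (y : 'I_n.+1 -> R) w : 1 < b ->
  \sum_j y j = (b - 1)^-1 -> exists z, run b z w = y /\ \sum_j z j = (b - 1)^-1.
Proof.
move=> b1 sy; elim: w => [|i w [z [zw sz]]]; first by exists y.
have b0 : 0 < b := lt_trans ltr01 b1.
exists (unstep b z i); split; last exact: unstep_sum.
by rewrite /= unstepK.
Qed.

(** The final state aimed at is the centre. It is pulled back along w and then to a central state z;
    coming close enough to z and playing v ++ w ends within th / 2 of the centre. *)
Lemma steer {R : realType} n (b : R) (x : 'I_n.+1 -> R) w :
  1 < b -> b ^+ rounds n <= 33%:R / 32%:R -> (b - 1) * n.+1%:R ^+ 3 <= 1 / 2 ->
  \sum_j x j = (b - 1)^-1 -> (forall j, 0 < x j) ->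
  exists u, forall j, 0 < run b x (u ++ w) j.
Proof.
move=> b1 g33 bn sx x0.
have N1 : 1 <= n.+1%:R :> R by rewrite ler1n.
pose th : R := (n.+1%:R * (b - 1))^-1.
have thE : n.+1%:R * th = (b - 1)^-1 by rewrite /th invfM mulrA divff ?mul1r // pnatr_eq0.
have th1 : 1 <= th.
  rewrite /th invf_ge1 ?mulr_gt0 //; [|lra..].
  have : n.+1%:R * 1 <= n.+1%:R * n.+1%:R ^+ 2 :> R by rewrite ler_wpM2l // exprn_ege1.
  rewrite -exprS mulr1 => h.
  have : (b - 1) * n.+1%:R <= (b - 1) * n.+1%:R ^+ 3 by rewrite ler_wpM2l //; lra.
  lra.
have [u0 hu0] := steer_center n b th x b1 th1 thE sx x0.
have [|z0 [z0w sz0]] := @preimage_word _ n b (fun=> th) w b1.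
  by rewrite sumr_const card_ord -(mulr_natl th).
have [v [z [zv sz hz]]] := central_preimage n b th z0 b1 (le_trans ler01 th1) thE sz0.
have B0 : 0 < b ^+ size (v ++ w) by rewrite exprn_gt0 //; lra.
have sx0 : \sum_j run b x u0 j = (b - 1)^-1 by rewrite run_sum // gt_eqF.
have eta0 : 0 < th / 2 / b ^+ size (v ++ w) by rewrite !divr_gt0 //; lra.
have [u1 hu1] := fine_steer n b th _ (run b x u0) z b1 g33 thE bn sx0 hu0 sz hz eta0.
exists (u0 ++ u1 ++ v) => j; rewrite -!catA !run_cat -(run_cat n b _ v w).
have := run_diff n b (run b (run b x u0) u1) z (v ++ w) j.
rewrite [run b z _]run_cat zv z0w => E.
have h : `|run b (run b x u0) u1 j - z j| * b ^+ size (v ++ w) <= th / 2.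
  by rewrite -ler_pdivlMr.
have := ler_norm (- (b ^+ size (v ++ w) * (run b (run b x u0) u1 j - z j))).
by rewrite normrN normrM (ger0_norm (ltW B0)); move: E h; lra.
Qed.

(** * Codings and weights *)

Definition open_hull {R : realType} {d n : nat} (p : 'I_n.+1 -> 'rV[R]_d) : set 'rV[R]_d :=
  [set x | exists t : 'I_n.+1 -> R,
    [/\ forall j, 0 < t j, \sum_j t j = 1 & x = \sum_j t j *: p j]].

Lemma compS_diff {R : realType} {d : nat} {I : Type} (lam : R) (p : I -> 'rV[R]_d) z z' a k m :
  compS z (fun i => hsim lam (p i)) a k m - compS z' (fun i => hsim lam (p i)) a k m =
  lam ^+ m *: (z - z').
Proof.
elim: m k => [|m IH] k /=; first by rewrite expr0 scale1r.
by rewrite /hsim opprD addrACA subrr addr0 -scalerBr IH scalerA exprS.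
Qed.

Lemma expr_lt_eventually {R : realType} (lam e : R) : 0 < lam -> lam < 1 -> 0 < e ->
  exists M, forall m, (M <= m)%N -> lam ^+ m < e.
Proof.
move=> lam0 lam1 e0.
have l1 : `|lam| < 1 by rewrite gtr0_norm.
have /cvgrPdist_lt /(_ _ e0) [M _ hM] := cvg_expr l1.
exists M => m /hM /=; rewrite sub0r normrN ger0_norm // exprn_ge0 // ltW //.
Qed.

(** Replacing the starting point y m by 0 changes the composition by at most lam^m K. *)
Lemma coding_of_bounded_orbit {R : realType} {d : nat} {I : Type} (lam : R) (p : I -> 'rV[R]_d)
    (a : nat -> I) (x : 'rV[R]_d) (y : nat -> 'rV[R]_d) (K : R) :
  0 < lam -> lam < 1 -> (forall m, `|y m| <= K) ->
  (forall m, compS (y m) (fun i => hsim lam (p i)) a 0 m = x) ->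
  is_coding (fun i => hsim lam (p i)) a x.
Proof.
move=> lam0 lam1 yK yx; apply/cvgrPdist_lt => e e0.
have K0 : 0 <= K := le_trans (normr_ge0 _) (yK 0%N).
have [M hM] := expr_lt_eventually lam (e / (K + 1)) lam0 lam1 (divr_gt0 e0 (ltr_pwDr ltr01 K0)).
exists M => // m /hM /= lm; rewrite -{1}(yx m) compS_diff subr0 normrZ.
rewrite ger0_norm ?exprn_ge0 ?(ltW lam0) //.
move: lm; rewrite ltr_pdivlMr; last by rewrite ltr_pwDr.
apply: le_lt_trans; rewrite ler_wpM2l ?exprn_ge0 ?(ltW lam0) //.
by apply: le_trans (yK m) _; rewrite lerDl.
Qed.

Lemma coding_mem {R : realType} {d : nat} {I : Type} (lam : R) (p : I -> 'rV[R]_d)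
    (a : nat -> I) (x : 'rV[R]_d) (X : set 'rV[R]_d) :
  0 < lam -> lam < 1 -> X !=set0 -> compact X ->
  (forall i y, X y -> X (hsim lam (p i) y)) ->
  is_coding (fun i => hsim lam (p i)) a x -> X x.
Proof.
move=> lam0 lam1 [x0 Xx0] cX SX cod.
have XS k m : X (compS x0 (fun i => hsim lam (p i)) a k m).
  by elim: m k => [//|m IH] k /=; exact: SX.
apply: (@closed_cvg _ _ \oo _ (fun m => compS x0 (fun i => hsim lam (p i)) a 0 m) X).
- by apply: compact_closed => //; exact: norm_hausdorff.
- by near=> m; exact: XS.
have -> : (fun m => compS x0 (fun i => hsim lam (p i)) a 0 m) =
  (fun m => compS 0 (fun i => hsim lam (p i)) a 0 m + lam ^+ m *: x0).
  by apply/funext => m; rewrite -[x0 in RHS]subr0 -(compS_diff lam p _ _ a 0) addrC subrK.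
rewrite -[x]addr0 -[X in _ + X](scale0r x0).
apply: cvgD => //; apply: cvgZl; apply: cvg_expr; rewrite gtr0_norm.
Unshelve. all: by end_near. Qed.

Lemma coding_exists {R : realType} {d : nat} {I : Type} (lam : R) (p : I -> 'rV[R]_d)
    (x : 'rV[R]_d) (X : set 'rV[R]_d) :
  0 < lam -> lam < 1 -> compact X ->
  (forall y, X y -> exists i z, X z /\ y = hsim lam (p i) z) -> X x ->
  exists a, is_coding (fun i => hsim lam (p i)) a x.
Proof.
move=> lam0 lam1 cX XS Xx.
have [i0 _] := XS x Xx.
have /choice[f hf] : forall y, exists iz : I * 'rV[R]_d, X y -> X iz.2 /\ y = hsim lam (p iz.1) iz.2.
  move=> y; case: (pselect (X y)) => [/XS[i [z [Xz yz]]]|nXy]; first by exists (i, z).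
  by exists (i0, y).
pose st m := iter m (fun y => (f y).2) x.
have Xst m : X (st m) by elim: m => [//|m /hf[]].
have cst k m : compS (st (k + m)%N) (fun i => hsim lam (p i)) (fun j => (f (st j)).1) k m = st k.
  elim: m k => [|m IH] k /=; first by rewrite addn0.
  by rewrite -addSnnS IH; have [_ <-] := hf _ (Xst k).
have [K [_ hK]] := compact_bounded cX.
exists (fun j => (f (st j)).1).
apply: (@coding_of_bounded_orbit _ _ _ _ _ _ _ st (K + 1)) => // [m|m].
  by apply: hK; [rewrite ltrDl|exact: Xst].
by rewrite -[in compS _ _ _ _ _](add0n m) cst.
Qed.

Lemma compS_weights {R : realType} {d n : nat} (lam : R) (p : 'I_n.+1 -> 'rV[R]_d) a k m :
  compS 0 (fun i => hsim lam (p i)) a k m =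
  \sum_j (\sum_(l < m) (1 - lam) * lam ^+ l * (a (k + l)%N == j)%:R) *: p j.
Proof.
elim: m k => [|m IH] k /=.
  by rewrite big1 // => j _; rewrite big_ord0 scale0r.
rewrite /hsim IH scaler_sumr.
have -> : (1 - lam) *: p (a k) = \sum_j ((1 - lam) * (a k == j)%:R) *: p j.
  rewrite (bigD1 (a k)) //= eqxx mulr1 big1 ?addr0 // => j /negbTE.
  by rewrite eq_sym => ->; rewrite mulr0 scale0r.
rewrite -big_split /=; apply: eq_bigr => j _.
rewrite scalerA -scalerDl big_ord_recl /= expr0 mulr1 addn0 addrC; congr ((_ + _) *: _).
rewrite mulr_sumr; apply: eq_bigr => l _.
by rewrite /bump /= add1n addSnnS exprS; ring.
Qed.

(** The weight of j is the sum of (1 - lam) lam^l over the positions l at which a takes the value j,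
    hence positive once j occurs. *)
Lemma coding_weights {R : realType} {d n : nat} (lam : R) (p : 'I_n.+1 -> 'rV[R]_d)
    (a : nat -> 'I_n.+1) (x : 'rV[R]_d) :
  0 < lam -> lam < 1 -> is_coding (fun i => hsim lam (p i)) a x ->
  exists t : 'I_n.+1 -> R, [/\ forall j, 0 <= t j, forall j k, a k = j -> 0 < t j,
    \sum_j t j = 1 & x = \sum_j t j *: p j].
Proof.
move=> lam0 lam1 cod; have l10 : 0 < 1 - lam by rewrite subr_gt0.
pose W j m := \sum_(l < m) (1 - lam) * lam ^+ l * (a l == j)%:R.
have term0 j l : 0 <= (1 - lam) * lam ^+ l * (a l == j)%:R.
  by rewrite !mulr_ge0 ?exprn_ge0 ?(ltW lam0) ?(ltW l10).
have sumW m : \sum_j W j m = 1 - lam ^+ m.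
  rewrite /W exchange_big /=.
  have -> : \sum_(l < m) \sum_j (1 - lam) * lam ^+ l * (a l == j)%:R = \sum_(l < m) (1 - lam) * lam ^+ l.
    apply: eq_bigr => l _; rewrite (bigD1 (a l)) //= eqxx mulr1 big1 ?addr0 // => j /negbTE.
    by rewrite eq_sym => ->; rewrite mulr0.
  elim: m => [|m IH]; first by rewrite big_ord0 expr0 subrr.
  by rewrite big_ord_recr IH /= exprS; ring.
have W0 j m : 0 <= W j m by apply: sumr_ge0 => l _; exact: term0.
have Wnd j : nondecreasing_seq (W j).
  apply/nondecreasing_seqP => m; by rewrite /W big_ord_recr /= lerDl; exact: term0.
have W1 j m : W j m <= 1.
  apply: (@le_trans _ _ (\sum_j W j m)).
    by rewrite (bigD1 j) //= lerDl; apply: sumr_ge0 => i _; exact: W0.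
  by rewrite sumW gerBl exprn_ge0 // ltW.
have cW j : cvgn (W j).
  by apply: nondecreasing_is_cvgn => //; exists 1 => _ [m _ <-]; exact: W1.
have leW j m : W j m <= limn (W j) by exact: nondecreasing_cvgn_le.
exists (fun j => limn (W j)); split.
- by move=> j; apply: le_trans (leW j 0%N).
- move=> j k ak; apply: lt_le_trans (leW j k.+1).
  rewrite /W big_ord_recr /= ak eqxx mulr1 ltr_pwDr ?mulr_gt0 ?exprn_gt0 //.
  exact: W0.
- have : (fun m => \sum_j W j m) @ \oo --> \sum_j limn (W j).
    by apply: cvg_big => [|j _]; [exact: add_continuous|exact: cW].
  have : (fun m => \sum_j W j m) @ \oo --> (1 : R).
    have -> : (fun m => \sum_j W j m) = (fun m => 1 - lam ^+ m) by apply/funext.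
    rewrite -[X in _ --> X]subr0; apply: cvgB; first exact: cvg_cst.
    by apply: cvg_expr; rewrite gtr0_norm.
  by move=> h1 h2; exact: (cvg_unique (@norm_hausdorff _ _) h2 h1).
- apply: (cvg_unique (@norm_hausdorff _ _) cod).
  have -> : (fun m => compS 0 (fun i => hsim lam (p i)) a 0 m) = (fun m => \sum_j W j m *: p j).
    by apply/funext => m; rewrite compS_weights.
  by apply: cvg_big => [|j _]; [exact: add_continuous|apply: cvgZl; exact: cW].
Qed.

(** * Universal codings from positive plays *)

(** Undoing a move preserves positivity, so only the end of a play has to be controlled. *)
Lemma run_pos_prefix {R : realType} n (b : R) (x : 'I_n.+1 -> R) u v : 0 < b ->
  (forall j, 0 < run b x (u ++ v) j) -> forall j, 0 < run b x u j.
Proof.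
move=> b0; rewrite run_cat; elim: v (run b x u) => [//|i v IH] y /IH h j.
have := h j; rewrite /step subr_gt0 => h1.
by rewrite -(pmulr_rgt0 _ b0); apply: le_lt_trans h1.
Qed.

Lemma compS_run {R : realType} {d n : nat} (lam : R) (p : 'I_n.+1 -> 'rV[R]_d)
    (x : 'I_n.+1 -> R) (a : nat -> 'I_n.+1) k m : 0 < lam ->
  compS (\sum_j ((lam^-1 - 1) * run lam^-1 x [seq a (k + l)%N | l <- iota 0 m] j) *: p j)
    (fun i => hsim lam (p i)) a k m =
  \sum_j ((lam^-1 - 1) * x j) *: p j.
Proof.
move=> lam0; elim: m k x => [//|m IH] k x /=; rewrite addn0.
have -> : [seq a (k + l)%N | l <- iota 1 m] = [seq a (k.+1 + l)%N | l <- iota 0 m].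
  by rewrite -[1%N]addn0 iotaDl -map_comp; apply: eq_map => l /=; rewrite addnA addn1.
rewrite IH /hsim scaler_sumr.
have -> : (1 - lam) *: p (a k) = \sum_j ((1 - lam) * (j == a k)%:R) *: p j.
  rewrite (bigD1 (a k)) //= eqxx mulr1 big1 ?addr0 // => j /negbTE ->.
  by rewrite mulr0 scale0r.
rewrite -big_split /=; apply: eq_bigr => j _; rewrite scalerA -scalerDl; congr (_ *: _).
by rewrite /step; field; rewrite gt_eqF.
Qed.

Lemma nth_prefix_limit {I : Type} (i0 : I) (pre : nat -> seq I) (s : nat -> seq I) :
  (forall k, pre k.+1 = pre k ++ s k) -> (forall k, (k <= size (pre k))%N) ->
  forall k m, (m < size (pre k))%N -> nth i0 (pre k) m = nth i0 (pre m.+1) m.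
Proof.
move=> preS sz k m mk.
have mono j l : (m < size (pre j))%N -> nth i0 (pre (j + l)%N) m = nth i0 (pre j) m /\ (m < size (pre (j + l)%N))%N.
  move=> mj; elim: l => [|l [IH1 IH2]]; first by rewrite addn0.
  by rewrite addnS preS nth_cat IH2 size_cat (leq_trans IH2) ?leq_addr.
have [h1 _] := mono k m.+1 mk; have [h2 _] := mono m.+1 k (sz m.+1).
by rewrite -h1 -h2 addnC.
Qed.

(** All finite words are enumerated; stage k steers to a state from which word k can be played with
    a positive outcome. *)
Lemma universal_orbit {R : realType} n (b : R) (x : 'I_n.+1 -> R) :
  0 < b -> b != 1 -> \sum_j x j = (b - 1)^-1 -> (forall j, 0 < x j) ->
  (forall (y : 'I_n.+1 -> R) w, \sum_j y j = (b - 1)^-1 -> (forall j, 0 < y j) ->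
     exists u, forall j, 0 < run b y (u ++ w) j) ->
  exists a : nat -> 'I_n.+1, universal a /\
    forall m j, 0 < run b x [seq a l | l <- iota 0 m] j.
Proof.
move=> b0 b1 sx x0 steer.
have /choice[U hU] : forall yw : ('I_n.+1 -> R) * seq 'I_n.+1, exists u,
    \sum_j yw.1 j = (b - 1)^-1 -> (forall j, 0 < yw.1 j) -> forall j, 0 < run b yw.1 (u ++ yw.2) j.
  move=> [y w] /=; case: (pselect (\sum_j y j = (b - 1)^-1 /\ forall j, 0 < y j)) => [[sy y0]|no].
    by have [u hu] := steer y w sy y0; exists u.
  by exists [::] => sy y0; exfalso; apply: no.
(* The extra letter makes every stage nonempty, so the prefixes grow; the default [::] serves codes
   of no word. *)
pose w k : seq 'I_n.+1 := rcons (odflt [::] (unpickle k)) ord0.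
pose pre := fix pre k := if k is k'.+1 then pre k' ++ (U (run b x (pre k'), w k') ++ w k') else [::].
have preS k : pre k.+1 = pre k ++ (U (run b x (pre k), w k) ++ w k) by [].
have sz k : (k <= size (pre k))%N.
  by elim: k => [//|k IH]; rewrite preS !size_cat size_rcons !addnS ltnS (leq_trans IH) // leq_addr.
have pos k : forall j, 0 < run b x (pre k) j.
  elim: k => [//|k IH] j; rewrite preS run_cat.
  by apply: (hU (run b x (pre k), w k)) => //=; rewrite run_sum.
pose a m := nth ord0 (pre m.+1) m.
have aE k m : (m < size (pre k))%N -> a m = nth ord0 (pre k) m.
  by move=> mk; rewrite (nth_prefix_limit ord0 pre _ preS sz k m mk).
exists a; split.
  move=> v; pose k := pickle v; pose q := size (pre k ++ U (run b x (pre k), w k)).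
  have wk : w k = rcons v ord0 by rewrite /w pickleK.
  exists q => i iv.
  have E j : (j < size v)%N -> a (q + j)%N = nth ord0 v j.
    move=> jv; rewrite (aE k.+1).
      by rewrite preS catA nth_cat ltnNge leq_addr /= addKn wk nth_rcons jv.
    by rewrite preS catA size_cat ltn_add2l wk size_rcons leqW.
  by rewrite E //; apply: set_nth_default.
move=> m; apply: (@run_pos_prefix _ n b x _ (drop m (pre m)) b0).
suff -> : [seq a l | l <- iota 0 m] = take m (pre m) by rewrite cat_take_drop; exact: pos.
apply: (@eq_from_nth _ ord0); first by rewrite size_map size_iota size_takel.
move=> i; rewrite size_map size_iota => im.
rewrite (nth_map 0%N) ?size_iota // nth_iota // add0n nth_take //.
by rewrite (aE m) // (leq_trans im).
Qed.

Lemma open_hull_uni {R : realType} {d n : nat} (lam : R) (p : 'I_n.+1 -> 'rV[R]_d) :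
  0 < lam -> lam < 1 -> lam^-1 ^+ rounds n <= 33%:R / 32%:R ->
  (lam^-1 - 1) * n.+1%:R ^+ 3 <= 1 / 2 ->
  open_hull p `<=` X_uni (fun i : 'I_n.+1 => hsim lam (p i)).
Proof.
move=> lam0 lam1 h1 h2 _ [t [t0 st ->]]; set b := lam^-1 in h1 h2.
have b1 : 1 < b by rewrite invf_gt1.
have bb : 0 < b - 1 by rewrite subr_gt0.
pose x j := t j / (b - 1).
have sx : \sum_j x j = (b - 1)^-1 by rewrite -mulr_suml st mul1r.
have x0 j : 0 < x j by rewrite divr_gt0.
have b0 : 0 < b := lt_trans ltr01 b1.
have b_neq1 : b != 1 by rewrite gt_eqF.
have [|a [ua apos]] := universal_orbit n b x b0 b_neq1 sx x0.
  by move=> y w sy y0; exact: steer.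
exists a; split => //.
have -> : \sum_j t j *: p j = \sum_j ((b - 1) * x j) *: p j.
  by apply: eq_bigr => j _; rewrite mulrC divfK // gt_eqF.
pose y m := run b x [seq a l | l <- iota 0 m].
apply: (@coding_of_bounded_orbit _ _ _ lam p a _
  (fun m => \sum_j ((b - 1) * y m j) *: p j) (\sum_j `|p j|)) => // m; last first.
  exact: (compS_run lam p x a 0 m lam0).
apply: le_trans (ler_norm_sum _ _ _) _; apply: ler_sum => j _.
rewrite normrZ -[leRHS]mul1r ler_wpM2r // ger0_norm; last by apply: mulr_ge0; apply: ltW => //; exact: apos.
have : \sum_j y m j = (b - 1)^-1 by rewrite run_sum // gt_eqF.
rewrite (bigD1 j) //= => E.
have : 0 <= \sum_(i < n.+1 | i != j) y m i by apply: sumr_ge0 => i _; apply: ltW; exact: apos.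
move=> h; have : y m j <= (b - 1)^-1 by rewrite -E lerDl.
by rewrite -[leRHS]div1r ler_pdivlMr // mulrC.
Qed.

Lemma uni_open_hull {R : realType} {d n : nat} (lam : R) (p : 'I_n.+1 -> 'rV[R]_d) :
  0 < lam -> lam < 1 ->
  X_uni (fun i : 'I_n.+1 => hsim lam (p i)) `<=` open_hull p.
Proof.
move=> lam0 lam1 x [a [ua cod]].
have [t [_ tpos st ->]] := coding_weights lam p a x lam0 lam1 cod.
exists t; split => // j; have [k hk] := ua [:: j].
by apply: (tpos j k); have := hk 0%N isT; rewrite addn0.
Qed.

(** * The open hull and the interior of X *)

(** The matrix with rows (p i, 1) has trivial kernel, since a kernel vector would be a hyperplane
    through all p i. The first d rows of a left inverse turn a displacement v into weights of sum
    0. *)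
Lemma hull_lift {R : realType} {d n : nat} (p : 'I_n.+1 -> 'rV[R]_d) :
  ~ in_affine_hyperplane (range p) ->
  exists L : 'M[R]_(d, n.+1), forall v : 'rV[R]_d,
    \sum_j (v *m L) 0 j = 0 /\ \sum_j (v *m L) 0 j *: p j = v.
Proof.
move=> hp; pose N : 'M[R]_(n.+1, d + 1) := \matrix_(i, j) (row_mx (p i) 1%:M) 0 j.
have Nl i j : N i (lshift 1 j) = p i 0 j by rewrite mxE row_mxEl.
have Nr i j : N i (rshift d j) = 1 by rewrite mxE row_mxEr [j]ord1 mxE eqxx.
have /row_fullP[L LN] : row_full N.
  have kerN (w : 'cV[R]_(d + 1)) : N *m w = 0 -> w = 0.
    move=> Nw.
    have Nwi i : dotv (usubmx w)^T (p i) + w (rshift d ord0) 0 = 0.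
      have := congr1 (fun M : 'cV[R]_n.+1 => M i 0) Nw.
      rewrite [in LHS]mxE [in RHS]mxE big_split_ord /= big_ord1 Nr mul1r => E; rewrite -[RHS]E; congr (_ + _).
      by apply: eq_bigr => j _; rewrite Nl !mxE mulrC.
    have [v0|v0] := eqVneq (usubmx w)^T 0; last first.
      exfalso; apply: hp; exists (usubmx w)^T, (- w (rshift d ord0) 0); split => // _ [i _ <-].
      by apply/eqP; rewrite -addr_eq0 Nwi.
    have u0 : usubmx w = 0 by rewrite -[usubmx w]trmxK v0 trmx0.
    have d0 : dsubmx w = 0.
      apply/colP => i; rewrite !mxE [i]ord1.
      by have := Nwi ord0; rewrite v0 /dotv big1 ?add0r => [|j _]; last by rewrite mxE mul0r.
    by rewrite -[w]vsubmxK u0 d0 col_mx0.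
  rewrite -cokermx_eq0; apply/eqP/matrixP => i k.
  have /kerN/(congr1 (fun M : 'cV[R]_(d + 1) => M i 0)) : N *m col k (cokermx N) = 0.
    by rewrite colE mulmxA mulmx_coker mul0mx.
  by rewrite !mxE.
exists (usubmx L) => v.
have E : v *m usubmx L *m N = row_mx v 0.
  have -> : v *m usubmx L = row_mx v 0 *m L.
    by rewrite -[L in RHS]vsubmxK mul_row_col mul0mx addr0.
  by rewrite -mulmxA LN mulmx1.
have E' j : \sum_i (v *m usubmx L) 0 i * N i j = row_mx v 0 0 j by rewrite -E mxE.
split.
  have := E' (rshift d ord0); rewrite row_mxEr [in RHS]mxE => E0; rewrite -[RHS]E0.
  by apply: eq_bigr => i _; rewrite Nr mulr1.
apply/rowP => j; have := E' (lshift 1 j); rewrite row_mxEl => <-.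
by rewrite summxE; apply: eq_bigr => i _; rewrite Nl mxE.
Qed.

Lemma normv_coord {R : realType} {d : nat} (v : 'rV[R]_d) j : `|v 0 j| <= `|v|.
Proof.
rewrite [leRHS]mx_normrE.
exact: (le_bigmax 0 (fun ij : 'I_1 * 'I_d => `|v ij.1 ij.2|) (0, j)).
Qed.

(** The lift of y - x is added to the weights of x; near x it is smaller than the least weight. *)
Lemma open_hull_open {R : realType} {d n : nat} (p : 'I_n.+1 -> 'rV[R]_d) :
  ~ in_affine_hyperplane (range p) -> open (open_hull p).
Proof.
move=> /hull_lift[L hL]; rewrite openE => x [t [t0 st xE]].
pose K := \sum_i \sum_j `|L i j|.
have K0 : 0 <= K by apply: sumr_ge0 => i _; apply: sumr_ge0.
have bound (v : 'rV[R]_d) j : `|(v *m L) 0 j| <= `|v| * K.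
  rewrite mxE; apply: le_trans (ler_norm_sum _ _ _) _; rewrite mulr_sumr.
  apply: ler_sum => i _; rewrite normrM ler_pM ?normv_coord //.
  by rewrite (bigD1 j) //= lerDl sumr_ge0.
have [m m0 hm] : exists2 m : R, 0 < m & forall j, m <= t j.
  exists (\big[Num.min/1]_j t j).
    by apply: lt_bigmin => // j _; exact: t0.
  by move=> j; exact: bigmin_le.
have e0 : 0 < m / (K + 1) by rewrite divr_gt0 // ltr_wpDl.
apply/nbhs_ballP; exists (m / (K + 1)) => // y; rewrite -ball_normE /= => xy.
exists (fun j => t j + ((y - x) *m L) 0 j); split.
- move=> j; have := bound (y - x) j; have := hm j; rewrite ler_norml distrC => tj /andP[h _].
  move: xy; rewrite ltr_pdivlMr; last by rewrite ltr_wpDl.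
  rewrite mulrDr mulr1.
  have := normr_ge0 (x - y); lra.
- by rewrite big_split /= st (proj1 (hL _)) addr0.
- have [_ h] := hL (y - x).
  transitivity (x + (y - x)); first by rewrite addrC subrK.
  move: (y - x) h => v h; rewrite xE -{1}h -big_split /=; apply: eq_bigr => j _.
  by rewrite scalerDl.
Qed.

(** Pushed slightly away from the barycentre c, the point x stays in X; so x is a mean of a point of
    the hull and c, the latter with positive weight. *)
Lemma interior_open_hull {R : realType} {d n : nat} (p : 'I_n.+1 -> 'rV[R]_d) (X : set 'rV[R]_d) :
  (forall x, X x -> exists t : 'I_n.+1 -> R,
     [/\ forall j, 0 <= t j, \sum_j t j = 1 & x = \sum_j t j *: p j]) ->
  X° `<=` open_hull p.
Proof.
move=> hX x xX; pose c := \sum_j n.+1%:R^-1 *: p j.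
have [s s0 Xs] : exists2 s : R, 0 < s & X (x + s *: (x - c)).
  have /nbhs_ballP[e /= e0 eX] := xX.
  exists (e / 2 / (`|x - c| + 1)); first by rewrite !divr_gt0 // ltr_wpDl.
  apply: eX; rewrite -ball_normE /= opprD addrA subrr add0r normrN normrZ.
  have D0 : 0 < `|x - c| + 1 by rewrite ltr_wpDl.
  rewrite ger0_norm; last by rewrite !divr_ge0 // ltW.
  rewrite mulrAC ltr_pdivrMr // mulrDr mulr1.
  have : 0 <= e * `|x - c| by rewrite mulr_ge0 // ltW.
  lra.
have [t [t0 st E]] := hX _ Xs.
have s1 : 0 < 1 + s by lra.
exists (fun j => (t j + s / n.+1%:R) / (1 + s)); split.
- by move=> j; rewrite divr_gt0 // ltr_wpDl // divr_gt0.
- rewrite -mulr_suml big_split /= st sumr_const card_ord -(mulr_natl (s / _)).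
  by rewrite mulrCA divff ?pnatr_eq0 // mulr1 divff // gt_eqF.
- have xE : (1 + s) *: x = \sum_j t j *: p j + s *: c.
    by rewrite -E -addrA -scalerDr subrK scalerDl scale1r.
  have -> : x = (1 + s)^-1 *: ((1 + s) *: x) by rewrite scalerA mulVf ?scale1r // gt_eqF.
  rewrite xE /c scaler_sumr -big_split /= scaler_sumr; apply: eq_bigr => j _.
  by rewrite scalerA -scalerDl scalerA mulrC.
Qed.

Theorem theorem1p2 (R : realType) (d n : nat) (p : 'I_n.+1 -> 'rV[R]_d) :
  ~ in_affine_hyperplane (range p) ->
  exists2 delta : R, 0 < delta &
    forall lam : R, 1 - delta < lam -> lam < 1 ->
    forall X : set 'rV[R]_d,
      X !=set0 -> compact X ->
      X = \bigcup_(i in [set: 'I_n.+1]) (hsim lam (p i) @` X) ->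
      X_uni (fun i : 'I_n.+1 => hsim lam (p i)) = interior X.
Proof.
move=> hp; set N : R := n.+1%:R; set P : R := (rounds n)%:R.
have N1 : 1 <= N by rewrite ler1n.
have N3 : 1 <= N ^+ 3 by rewrite exprn_ege1.
have P1 : 1 <= P by rewrite ler1n addn_gt0 muln_gt0 expn_gt0 orbT.
have PN : 1 <= P * N ^+ 3 by rewrite -[leLHS]mulr1 ler_pM.
(* By Bernoulli, lam to the power [rounds n] is then at least 99/100 > 32/33; also (1 - lam) N^3 <=
   1/100. *)
exists (100%:R * (P * N ^+ 3))^-1; first by rewrite invr_gt0 mulr_gt0 //; lra.
move=> lam hlam lam1 X X0 cX XE.
set delta := (_^-1) in hlam.
have dPN : delta * (P * N ^+ 3) = 1 / 100%:R by rewrite /delta invfM -mulrA mulVf ?mulr1 ?div1r // gt_eqF //; lra.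
have d0 : 0 < delta by rewrite /delta invr_gt0 mulr_gt0 //; lra.
have dP : delta * P <= 1 / 100%:R.
  rewrite -dPN mulrA -[leLHS]mulr1 ler_wpM2l // mulr_ge0 //; lra.
have dN : delta * N ^+ 3 <= 1 / 100%:R.
  rewrite -dPN ler_wpM2l ?(ltW d0) // -[leLHS]mul1r ler_wpM2r //; lra.
have d1 : delta <= 1 / 100%:R.
  by apply: le_trans dP; rewrite -[leLHS]mulr1 ler_wpM2l // ltW.
have lam0 : 0 < lam by lra.
have h1 : lam^-1 ^+ rounds n <= 33%:R / 32%:R.
  have bern k : 1 - k%:R * delta <= lam ^+ k.
    elim: k => [|k IH]; first by rewrite expr0; lra.
    rewrite exprS -natr1.
    have : 0 <= lam * (lam ^+ k - (1 - k%:R * delta)) by apply: mulr_ge0; lra.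
    have : 0 <= (lam - (1 - delta)) + k%:R * delta * (1 - lam).
      by rewrite addr_ge0 // ?mulr_ge0 //; lra.
    lra.
  have := bern (rounds n); rewrite -/P mulrC => hb.
  rewrite exprVn -[leRHS]invrK lef_pV2 ?posrE ?exprn_gt0 // ?invr_gt0; lra.
have h2 : (lam^-1 - 1) * N ^+ 3 <= 1 / 2.
  have -> : lam^-1 - 1 = (1 - lam) / lam by field; lra.
  rewrite mulrAC ler_pdivrMr //.
  have : (1 - lam) * N ^+ 3 <= delta * N ^+ 3 by rewrite ler_wpM2r //; lra.
  lra.
have uniO : X_uni (fun i : 'I_n.+1 => hsim lam (p i)) = open_hull p.
  by apply/seteqP; split; [exact: uni_open_hull|exact: open_hull_uni].
have SX i y : X y -> X (hsim lam (p i) y).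
  by move=> Xy; rewrite XE; exists i => //; exists y.
have XS y : X y -> exists i z, X z /\ y = hsim lam (p i) z.
  by move=> Xy; have := Xy; rewrite {1}XE => -[i _ [z Xz <-]]; exists i, z.
rewrite uniO; apply/seteqP; split.
  rewrite -open_subsetE; last exact: open_hull_open.
  by rewrite -uniO => x [a [_ cod]]; exact: (coding_mem lam p a x X).
apply: interior_open_hull => x Xx.
have [a cod] := coding_exists lam p x X lam0 lam1 cX XS Xx.
by have [t [t0 _ st xE]] := coding_weights lam p a x lam0 lam1 cod; exists t.
Qed.
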